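(* Let $N\ge1$, $\beta>0$, let $\Lambda$ be a finite graph, let $s=(\ell_1,\dots,\ell_n)$ be a string and $(i,j)$ a location in $s$. Write $\phi(s)=\langle W_s\rangle_{\Lambda,\beta}$. For lattice Yang–Mills theory with gauge group $SU(N)$, $$\begin{aligned}\Big(1-\frac{t(i,j)}{N^2}\Big)\phi(s)=&-\sum_{s'\in\mathbb S_+((i,j),s)}\phi(s')+\sum_{s'\in\mathbb S_-((i,j),s)}\phi(s')-\frac1{N^2}\sum_{s'\in\mathbb M_+^U((i,j),s)}\phi(s')+\frac1{N^2}\sum_{s'\in\mathbb M_-^U((i,j),s)}\phi(s')\\&-\beta\sum_{s'\in\mathbb D_+((i,j),s)}\phi(s')+\beta\sum_{s'\in\mathbb D_-((i,j),s)}\phi(s')-\beta\sum_{s'\in\mathbb E_+((i,j),s)}\phi(s')+\beta\sum_{s'\in\mathbb E_-((i,j),s)}\phi(s').\end{aligned}$$ For lattice Yang–Mills theory with gauge group $SO(N)$, $$\begin{aligned}\Big(1-\frac1N\Big)\phi(s)=&-\sum_{s'\in\mathbb S_+((i,j),s)}\phi(s')+\sum_{s'\in\mathbb S_-((i,j),s)}\phi(s')-\frac1{N^2}\sum_{s'\in\mathbb M_+((i,j),s)}\phi(s')+\frac1{N^2}\sum_{s'\in\mathbb M_-((i,j),s)}\phi(s')\\&-\frac1N\sum_{s'\in\mathbb T_+((i,j),s)}\phi(s')+\frac1N\sum_{s'\in\mathbb T_-((i,j),s)}\phi(s')-2\beta\sum_{s'\in\mathbb D_+((i,j),s)}\phi(s')+2\beta\sum_{s'\in\mathbb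 D_-((i,j),s)}\phi(s').\end{aligned}$$
   Context: Lattice Yang–Mills with gauge group $G$: $\Lambda$ is a finite graph, $E_\Lambda^+$ contains one orientation of each edge. To each $e\in E_\Lambda^+$ is assigned $Q_e\in G$, with $Q_{e^{-1}}=Q_e^{-1}$; for a path $p=(e_1,\dots,e_k)$, $Q_p=Q_{e_1}\cdots Q_{e_k}$. A loop is a directed closed path up to cyclic reordering. $\mathcal P$ is a finite set of loops (plaquettes) closed under orientation reversal (usually directed unit squares). The measure is $Z^{-1}\prod_{p\in\mathcal P}\exp(N\beta\,\mathrm{Tr}(Q_p))\prod_{e\in E_\Lambda^+}dQ_e$, $dQ_e$ normalized Haar measure on $G$. A string is a finite collection of loops $s=(\ell_1,\dots,\ell_n)$; $W_s(Q)=\prod_i\frac1N\mathrm{Tr}(Q_{\ell_i})$, and $\langle W_s\rangle_{\Lambda,\beta}$ is its expectation. The empty loop has $\frac1N\mathrm{Tr}=1$. Fix a starting point for each loop; location $(i,j)$ is the $j$-th edge of $\ell_i$. Let $e$ be the oriented edge at $(i,j)$. $t(i,j)$ is the number of occurrences of $e$ in $s$ minus the number of occurrences of $e^{-1}$ in $s$. The following are indexed families (counted with multiplicity, one member for each indicated choice); unchanged loops of $s$ are kept; capital letters denote sub-paths, possibly empty, and $X^{-1}$ is the reversal of $X$. $\mathbb S_+$: for each $k\ne j$ such that the edge at $(i,k)$ is $e$, write $\ell_i=AeBeC$ (displayed $e$'s at the two locations) and replace $\ell_i$ by the two loops $AeC$, $Be$. $\mathbb S_-$: for each $k$ such that the edge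 at $(i,k)$ is $e^{-1}$, write $\ell_i=AeBe^{-1}C$ or $Ae^{-1}BeC$ and replace $\ell_i$ by the two loops $AC$, $B$. $\mathbb M_+^U$: for each location $(r,m)$, $r\ne i$, with edge $e$, write $\ell_i=AeB$, $\ell_r=CeD$ and replace both by $AeDCeB$. $\mathbb M_-^U$: for each location $(r,m)$, $r\ne i$, with edge $e^{-1}$, write $\ell_i=AeB$, $\ell_r=Ce^{-1}D$ and replace both by $ADCB$. $\mathbb M_+$: the members of $\mathbb M_+^U$ together with: for each location $(r,m)$, $r\ne i$, with edge $e^{-1}$, write $\ell_i=AeB$, $\ell_r=Ce^{-1}D$ and replace both by $AeC^{-1}D^{-1}eB$. $\mathbb M_-$: the members of $\mathbb M_-^U$ together with: for each location $(r,m)$, $r\ne i$, with edge $e$, write $\ell_i=AeB$, $\ell_r=CeD$ and replace both by $AC^{-1}D^{-1}B$. $\mathbb T_+$: for each $k$ such that the edge at $(i,k)$ is $e^{-1}$: if $k>j$, write $\ell_i=AeCe^{-1}D$ and replace it by $AeC^{-1}e^{-1}D$; if $k<j$, write $\ell_i=Ee^{-1}FeB$ and replace it by $Ee^{-1}F^{-1}eB$. $\mathbb T_-$: for each $k\ne j$ such that the edge at $(i,k)$ is $e$: if $k>j$, write $\ell_i=AeCeD$ and replace it by $AC^{-1}D$; if $k<j$, write $\ell_i=EeFeC$ and replace it by $EF^{-1}C$. $\mathbb D_+$: for each $p\in\mathcal P$ and each occurrence of $e$ in $p$, write $\ell_i=AeB$, $p=CeD$ and replace $\ell_i$ by $AeDCeB$.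 $\mathbb D_-$: for each $p\in\mathcal P$ and each occurrence of $e^{-1}$ in $p$, write $\ell_i=AeB$, $p=Ce^{-1}D$ and replace $\ell_i$ by $ADCB$. $\mathbb E_+$ (positive expansions): for each $p\in\mathcal P$ and each occurrence of $e^{-1}$ in $p$, add the loop $p$ to the collection $s$. $\mathbb E_-$ (negative expansions): for each $p\in\mathcal P$ and each occurrence of $e$ in $p$, add the loop $p$ to the collection $s$. *)

(* Defs.v *)
From HB Require Import structures.
From mathcomp Require Import all_boot all_order all_algebra.
From mathcomp Require Import all_classical all_reals all_analysis.
From mathcomp Require Import spectral complex.
Set Implicit Arguments.
Unset Strict Implicit.
Unset Printing Implicit Defensive.
Import Order.TTheory GRing.Theory Num.Theory.
Import numFieldNormedType.Exports.
Local Open Scope classical_set_scope.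
Local Open Scope ring_scope.
Local Open Scope complex_scope.

(* [pedge] is E_Lambda^+: one chosen orientation, from [esrc] to [etgt], of
   each edge. Multiple edges and self-loops are allowed. *)
Record finite_graph := FiniteGraph {
  vertex : finType;
  pedge : finType;
  esrc : pedge -> vertex;
  etgt : pedge -> vertex }.

Section Paths.
Variable L : finite_graph.

(* [(a, true)] is the chosen orientation of [a], [(a, false)] its inverse. *)
Definition oedge : finType := (pedge L * bool)%type.

Implicit Types (e : oedge) (l p q : seq oedge).

Definition oinv e : oedge := (e.1, ~~ e.2).
Definition osrc e : vertex L := if e.2 then esrc e.1 else etgt e.1.
Definition otgt e : vertex L := if e.2 then etgt e.1 else esrc e.1.

(* Loops carry a starting point; they are compared modulo [cyc_eq]. The empty
   sequence is the empty loop. *)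
Definition is_loop l : bool := cycle (fun e f => otgt e == osrc f) l.

Definition revp l : seq oedge := rev (map oinv l).

Definition cyc_eq p q : bool := [exists n : 'I_(size p).+1, q == rot n p].

Definition plaquette_set (P : seq (seq oedge)) : Prop :=
  [/\ all is_loop P,
      pairwise (fun p q => ~~ cyc_eq p q) P
    & forall p, p \in P -> exists2 q, q \in P & cyc_eq (revp p) q].

Definition string : Type := seq (seq oedge).

Implicit Types (s : string) (P : seq (seq oedge)).

Definition loop_at s (i : nat) : seq oedge := nth [::] s i.

(* [None] when [(i, j)] is not a location of [s]. *)
Definition edge_at s (i j : nat) : option oedge := onth (loop_at s i) j.

Definition occ e l : seq nat :=
  [seq k <- iota 0 (size l) | onth l k == Some e].

Definition bef (k : nat) l : seq oedge := take k l.
Definition aft (k : nat) l : seq oedge := drop k.+1 l.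
(* the edges strictly between positions [a < b] *)
Definition btw (a b : nat) l : seq oedge := drop a.+1 (take b l).

Definition replace s (i : nat) (ls : seq (seq oedge)) : string :=
  take i s ++ ls ++ drop i.+1 s.

(* loop [i] becomes [l] and loop [r] disappears *)
Definition replace2 s (i r : nat) l : string :=
  [seq if k == i then l else loop_at s k
     | k <- [seq k <- iota 0 (size s) | k != r]].

Definition others s (i : nat) : seq nat :=
  [seq r <- iota 0 (size s) | r != i].

Definition tcount e s : int :=
  \sum_(l <- s) ((count_mem e l)%:Z - (count_mem (oinv e) l)%:Z).

(* [e] is meant to be the edge at location [(i, j)] of [s]. Since [oinv e]
   differs from [e], only the families over [occ e (loop_at s i)] must exclude
   [k = j]. *)
Section Operations.
Variables (P : seq (seq oedge)) (e : oedge) (i j : nat) (s : string).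

Let l := loop_at s i.
Let A := bef j l.
Let B := aft j l.

Definition split_pos : seq string :=
  [seq let a := minn j k in let b := maxn j k in
       replace s i [:: bef a l ++ [:: e] ++ aft b l; btw a b l ++ [:: e]]
     | k <- [seq k <- occ e l | k != j]].

Definition split_neg : seq string :=
  [seq let a := minn j k in let b := maxn j k in
       replace s i [:: bef a l ++ aft b l; btw a b l]
     | k <- occ (oinv e) l].

Definition mergeU_pos : seq string :=
  [seq let C := bef m (loop_at s r) in let D := aft m (loop_at s r) in
       replace2 s i r (A ++ [:: e] ++ D ++ C ++ [:: e] ++ B)
     | r <- others s i, m <- occ e (loop_at s r)].

Definition mergeU_neg : seq string :=
  [seq let C := bef m (loop_at s r) in let D := aft m (loop_at s r) in
       replace2 s i r (A ++ D ++ C ++ B)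
     | r <- others s i, m <- occ (oinv e) (loop_at s r)].

Definition merge_pos : seq string :=
  mergeU_pos ++
  [seq let C := bef m (loop_at s r) in let D := aft m (loop_at s r) in
       replace2 s i r (A ++ [:: e] ++ revp C ++ revp D ++ [:: e] ++ B)
     | r <- others s i, m <- occ (oinv e) (loop_at s r)].

Definition merge_neg : seq string :=
  mergeU_neg ++
  [seq let C := bef m (loop_at s r) in let D := aft m (loop_at s r) in
       replace2 s i r (A ++ revp C ++ revp D ++ B)
     | r <- others s i, m <- occ e (loop_at s r)].

Definition twist_pos : seq string :=
  [seq replace s i
         [:: if (j < k)%N
             then A ++ [:: e] ++ revp (btw j k l) ++ [:: oinv e] ++ aft k l
             else bef k l ++ [:: oinv e] ++ revp (btw k j l) ++ [:: e] ++ B]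
     | k <- occ (oinv e) l].

Definition twist_neg : seq string :=
  [seq replace s i
         [:: if (j < k)%N
             then A ++ revp (btw j k l) ++ aft k l
             else bef k l ++ revp (btw k j l) ++ B]
     | k <- [seq k <- occ e l | k != j]].

Definition deform_pos : seq string :=
  [seq replace s i [:: A ++ [:: e] ++ aft m p ++ bef m p ++ [:: e] ++ B]
     | p <- P, m <- occ e p].

Definition deform_neg : seq string :=
  [seq replace s i [:: A ++ aft m p ++ bef m p ++ B]
     | p <- P, m <- occ (oinv e) p].

Definition expand_pos : seq string :=
  [seq rcons s p | p <- P, m <- occ (oinv e) p].

Definition expand_neg : seq string :=
  [seq rcons s p | p <- P, m <- occ e p].

End Operations.
End Paths.

Record matrix_group (K : numFieldType) (N : nat) := MatrixGroup {
  mg_set : set 'M[K]_N;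
  mg_unit : mg_set `<=` [set M | M \in unitmx];
  mg_one : mg_set 1%:M;
  mg_mul : forall M M', mg_set M -> mg_set M' -> mg_set (M *m M');
  mg_inv : forall M, mg_set M -> mg_set (invmx M) }.

Section Haar.
Variables (K : numFieldType) (N : nat) (G : matrix_group K N).

(* [set_type] carries the subspace topology inherited from 'M[K]_N. *)
Definition gelt : Type := set_type (mg_set G).
HB.instance Definition _ := Topological.on gelt.

Definition gone : gelt := exist _ 1%:M (mem_set (mg_one G)).
HB.instance Definition _ := isPointed.Build gelt gone.

Definition gmul (g h : gelt) : gelt :=
  exist _ (val g *m val h)
    (mem_set (mg_mul (set_mem (valP g)) (set_mem (valP h)))).

Definition gborel : Type := g_sigma_algebraType (@open gelt).
HB.instance Definition _ := Measurable.on gborel.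

(* Left invariance determines a Borel probability on a compact group, where it
   implies right invariance. *)
Definition is_haar (R : realType) (mu : probability gborel R) : Prop :=
  forall (g : gelt) (A : set gborel),
    measurable A -> mu (gmul g @` A) = mu A.

Variable E : finType.

Definition cylinders : set (set (E -> gborel)) :=
  [set C | exists a (A : set gborel),
     measurable A /\ C = [set Q | A (Q a)]].

Definition gconfig : Type := g_sigma_algebraType cylinders.
HB.instance Definition _ := Measurable.on gconfig.

(* [nu] is the product over [E] of copies of [mu]; it is unique since the
   boxes form a pi-system generating the product sigma-algebra. *)
Definition is_product (R : realType) (mu : probability gborel R)
    (nu : probability gconfig R) : Prop :=
  forall A : E -> set gborel, (forall a, measurable (A a)) ->
    nu [set Q | forall a, A a (Q a)] = (\prod_(a : E) mu (A a))%E.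

End Haar.

Section SUSO.
Variables (R : realType) (N : nat).

Definition SU_set : set 'M[R[i]]_N :=
  [set M | M \is unitarymx /\ \det M = 1].

Definition SO_set : set 'M[R]_N :=
  [set M | M *m M^T = 1%:M /\ \det M = 1].

Lemma SU_unit : SU_set `<=` [set M | M \in unitmx].
Proof. by move=> M [/unitarymx_unit]. Qed.

Lemma SU_one : SU_set 1%:M.
Proof.
split; last exact: det1.
by apply/unitarymxP; rewrite trmx1 map_mx1 mulmx1.
Qed.

Lemma SU_mul M M' : SU_set M -> SU_set M' -> SU_set (M *m M').
Proof.
move=> [uM dM] [uM' dM']; split; first exact: mul_unitarymx.
by rewrite det_mulmx dM dM' mulr1.
Qed.

Lemma SU_inv M : SU_set M -> SU_set (invmx M).
Proof.
move=> [uM dM]; split; last by rewrite det_inv dM invr1.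
by rewrite invmx_unitary // trmxC_unitary.
Qed.

Definition SU : matrix_group _ N := MatrixGroup SU_unit SU_one SU_mul SU_inv.

Lemma SO_unit : SO_set `<=` [set M | M \in unitmx].
Proof. by move=> M [/mulmx1_unit[]]. Qed.

Lemma SO_one : SO_set 1%:M.
Proof. by split; rewrite ?det1 // trmx1 mulmx1. Qed.

Lemma SO_mul M M' : SO_set M -> SO_set M' -> SO_set (M *m M').
Proof.
move=> [uM dM] [uM' dM']; split; last by rewrite det_mulmx dM dM' mulr1.
by rewrite trmx_mul mulmxA -(mulmxA M) uM' mulmx1.
Qed.

Lemma SO_inv M : SO_set M -> SO_set (invmx M).
Proof.
move=> [uM dM]; split; last by rewrite det_inv dM invr1.
have [Mu _] := mulmx1_unit uM.
have -> : invmx M = M^T by rewrite -[RHS]mul1mx -(mulVmx Mu) -mulmxA uM mulmx1.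
by rewrite trmxK; exact: mulmx1C.
Qed.

Definition SO : matrix_group _ N := MatrixGroup SO_unit SO_one SO_mul SO_inv.

End SUSO.

Section Wilson.
Variables (K : numFieldType) (N : nat) (G : matrix_group K N) (L : finite_graph).
Implicit Type Q : gconfig G (pedge L).

Definition link Q (x : oedge L) : 'M[K]_N :=
  if x.2 then val (Q x.1) else invmx (val (Q x.1)).

Definition holonomy Q (p : seq (oedge L)) : 'M[K]_N :=
  \big[mulmx/1%:M]_(x <- p) link Q x.

Definition wilson (s : string L) Q : K :=
  \prod_(l <- s) (N%:R^-1 * \tr (holonomy Q l)).

End Wilson.

Section Expectations.
Variables (R : realType) (N : nat) (L : finite_graph).
Variables (P : seq (seq (oedge L))) (beta : R).

Definition cexp (z : R[i]) : R[i] :=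
  (expR (complex.Re z))%:C * (cos (complex.Im z) +i* sin (complex.Im z)).

Definition cintegral d (T : measurableType d)
    (nu : {measure set T -> \bar R}) (f : T -> R[i]) : R[i] :=
  Rintegral nu setT (fun x => complex.Re (f x)) +i*
  Rintegral nu setT (fun x => complex.Im (f x)).

Definition weightSU (Q : gconfig (SU R N) (pedge L)) : R[i] :=
  \prod_(p <- P) cexp (N%:R * beta%:C * \tr (holonomy Q p)).

(* [nu] stands for the product Haar measure *)
Definition phiSU (nu : probability (gconfig (SU R N) (pedge L)) R)
    (s : string L) : R[i] :=
  (cintegral nu weightSU)^-1 *
  cintegral nu (fun Q => wilson s Q * weightSU Q).

Definition weightSO (Q : gconfig (SO R N) (pedge L)) : R :=
  \prod_(p <- P) expR (N%:R * beta * \tr (holonomy Q p)).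

Definition phiSO (nu : probability (gconfig (SO R N) (pedge L)) R)
    (s : string L) : R :=
  (Rintegral nu setT weightSO)^-1 *
  Rintegral nu setT (fun Q => wilson s Q * weightSO Q).

End Expectations.

(* Main.v *)
Require Import Defs.
From mathcomp Require Import all_boot all_order all_algebra.
From mathcomp Require Import all_classical all_reals all_analysis.
From mathcomp Require Import measurable_realfun spectral complex ring lra zify.
Import Order.TTheory GRing.Theory Num.Theory.
Local Open Scope ring_scope.
Local Open Scope complex_scope.

(** The identities are integration by parts on the gauge group, applied to one
    link. Let [e] be the marked edge, and write the marked loop cyclically as
    [e w]. For matrices X and Y consider

      F_Y = tr (Y Q_e Q_w) * (the other Wilson loops) * (the Boltzmann weight).

    Left translation of the link by a path in the group with velocity X
    preserves the product Haar measure, so the integral of the derivative D_X F_Y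
    vanishes; the right-hand sides of the theorem are what remains of D_X F_Y
    after X and Y are summed over dual bases.

    The derivative D_X inserts X at every occurrence of [e] and -X at every
    occurrence of the inverse edge: in the marked loop (splittings, twistings,
    and the term N tr from the marked occurrence itself), in the other loops
    (mergers) and in the exponent of the weight (deformations). Summing over the
    elementary matrices X = E_ab, Y = E_ba, a trace that contains both X and Y
    is cut into a product of two traces ([conj_contract_in]), and two traces that
    contain one of them each are joined ([conj_contract_out]). With X = Y = E_ba
    the same two operations occur with one of the pieces transposed, which for
    orthogonal matrices reverses a word. This gives the pointwise identities
    [loop_identity_sl] and [loop_identity_so].

    The complexified Lie algebra of SU(N) is sl(N), so the sum over the E_ab
    must be corrected by the scalar direction X = 1. On a word, D_1 counts
    occurrences of [e] with sign; hence the term t / N^2 from the loops and the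
    expansion terms from the weight. For SO(N) the directions are E_ab - E_ba;
    the transposed deformations equal the plain ones because the set of
    plaquettes is closed under reversal ([sum_osum_revp]), hence the factor 2.

    The analysis avoids differentiation under the integral sign. All functions
    involved are bounded and measurable and satisfy, uniformly in the
    configuration, f (g_t Q) = f Q + t (D_X f) Q + O(t^2) ([has_deriv]). This
    class is closed under sums, products and the exponential, and integrating
    the expansion gives t * (integral of D_X f) = O(t^2), so the integral is zero
    ([integral_has_deriv]). The paths are the rotations
    1 + sin t X + (1 - cos t) X^2 with X^3 = -X, for which the expansion is
    elementary; the directions X for which they lie in the group span the Lie
    algebra. Functions with values in R[i] serve for both groups, SO(N) being
    read through the inclusion of R in R[i]. *)

Set Implicit Arguments.
Unset Strict Implicit.
Unset Printing Implicit Defensive.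

(** * Occurrences of an edge in a word *)

Local Notation oinv := Defs.oinv.

Section Occurrences.
Variables (L : finite_graph) (V : zmodType).
Implicit Types (e x : oedge L) (l : seq (oedge L)).

Lemma oinvK e : oinv (oinv e) = e.
Proof. by case: e => a b; rewrite /oinv /= negbK. Qed.

Lemma oinv_neq e : (oinv e == e) = false.
Proof. by case: e => a []; apply/negP => /eqP[]. Qed.

Lemma oinv_neqC e : (e == oinv e) = false.
Proof. by rewrite eq_sym oinv_neq. Qed.

Lemma occ_cons e x l :
  occ e (x :: l) = (if x == e then [:: 0%N] else [::]) ++ map S (occ e l).
Proof.
rewrite /occ /= (inj_eq Some_inj) -[1%N]/(1 + 0)%N iotaDl filter_map.
by case: eqP.
Qed.

Lemma occ_cat e l1 l2 :
  occ e (l1 ++ l2) = occ e l1 ++ map (addn (size l1)) (occ e l2).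
Proof.
elim: l1 => [|x l1 IH]; first by rewrite -[LHS]map_id.
by rewrite cat_cons !occ_cons IH map_cat -catA -map_comp.
Qed.

Lemma occ_lt e l k : k \in occ e l -> (k < size l)%N.
Proof. by rewrite mem_filter mem_iota => /andP[_]. Qed.

(** Every family of string operations runs over the ways to write a word as
    C x D with [x = e]; [g] receives the words C and D around the occurrence. *)
Definition osum e l (g : seq (oedge L) -> seq (oedge L) -> V) : V :=
  \sum_(k <- occ e l) g (take k l) (drop k.+1 l).

Lemma osum_nil e g : osum e [::] g = 0.
Proof. exact: big_nil. Qed.

Lemma osum_cat e l1 l2 g :
  osum e (l1 ++ l2) g =
  osum e l1 (fun C D => g C (D ++ l2)) + osum e l2 (fun C D => g (l1 ++ C) D).
Proof.
rewrite /osum occ_cat big_cat big_map /=; congr (_ + _).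
  apply: eq_big_seq => k /occ_lt kl; rewrite takel_cat 1?ltnW // drop_cat.
  case: ltnP => // lk; have -> : k.+1 = size l1 by apply/eqP; rewrite eqn_leq kl.
  by rewrite drop_size subnn drop0.
apply: eq_bigr => k _.
rewrite take_cat drop_cat ltnNge leq_addr /= ltnNge.
by rewrite leqW ?leq_addr //= -addnS !addKn.
Qed.

Lemma osum_cons e x l g :
  osum e (x :: l) g =
  (if x == e then g [::] l else 0) + osum e l (fun C D => g (x :: C) D).
Proof.
rewrite -cat1s osum_cat; congr (_ + _).
by rewrite /osum occ_cons /=; case: eqP => _; rewrite ?big_nil ?big_seq1.
Qed.

Lemma eq_osum e l g h : (forall C D, g C D = h C D) -> osum e l g = osum e l h.
Proof. by move=> gh; apply: eq_bigr. Qed.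

Lemma occ_sum_others e A B (h : nat -> V) :
  \sum_(k <- [seq k <- occ e (A ++ e :: B) | k != size A]) h k =
  \sum_(k <- occ e A) h k + \sum_(k <- occ e B) h (size A + k.+1)%N.
Proof.
rewrite occ_cat occ_cons eqxx map_cat /= addn0 filter_cat /= eqxx /= big_cat /=.
rewrite -map_comp; congr (_ + _).
  rewrite big_filter big_seq_cond [RHS]big_seq_cond; apply: eq_bigl => k.
  by case: (boolP (k \in _)) => // /occ_lt /ltn_eqF ->.
rewrite big_filter big_map /=; apply: eq_bigl => k.
by rewrite -[X in _ != X]addn0 eqn_add2l.
Qed.

Lemma occ_sum_oinv e A B (h : nat -> V) :
  \sum_(k <- occ (oinv e) (A ++ e :: B)) h k =
  \sum_(k <- occ (oinv e) A) h k + \sum_(k <- occ (oinv e) B) h (size A + k.+1)%N.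
Proof.
by rewrite occ_cat occ_cons oinv_neqC /= big_cat !big_map.
Qed.

Lemma osum_const e l (v : V) : osum e l (fun _ _ => v) = v *+ count_mem e l.
Proof.
elim: l => [|x l IH]; first by rewrite osum_nil.
by rewrite osum_cons IH /= mulrnDr; case: eqP.
Qed.

Lemma exchange_osum (I : Type) (r : seq I) e l g :
  \sum_(a <- r) osum e l (g a) = osum e l (fun C D => \sum_(a <- r) g a C D).
Proof. exact: exchange_big. Qed.

End Occurrences.

Lemma osum_raddf (L : finite_graph) (V W : zmodType) (f : {additive V -> W})
    (e : oedge L) l g :
  f (osum e l g) = osum e l (fun C D => f (g C D)).
Proof. exact: raddf_sum. Qed.

Lemma mulr_osumr (L : finite_graph) (K : pzRingType) (e : oedge L) l (c : K) g :
  c * osum e l g = osum e l (fun C D => c * g C D).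
Proof. exact: mulr_sumr. Qed.

Lemma mulr_osuml (L : finite_graph) (K : pzRingType) (e : oedge L) l (c : K) g :
  osum e l g * c = osum e l (fun C D => g C D * c).
Proof. exact: mulr_suml. Qed.

(** * Sums over the elementary matrices *)

Section Contraction.
Variables (K : comNzRingType) (N : nat).
Implicit Types A B P Q : 'M[K]_N.

Local Notation E := (@delta_mx K N N).

Lemma mxtrace_delta_mul a b A : \tr (E a b *m A) = A b a.
Proof.
rewrite /mxtrace (bigD1 a) //= mxE (bigD1 b) //= mxE !eqxx mul1r.
rewrite big1 => [|c cb]; last by rewrite mxE (negbTE cb) andbF mul0r.
rewrite addr0 big1 ?addr0 // => c ca; rewrite mxE big1 // => d _.
by rewrite mxE (negbTE ca) mul0r.
Qed.

(* Two facts are behind the contractions: sum E_ba A E_ab = (tr A) 1 and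
   sum E_ba A E_ba = A^T; each occurs inside one trace and across two. *)

Lemma contract_in A B :
  \sum_a \sum_b \tr (E b a *m A *m E a b *m B) = \tr A * \tr B.
Proof.
rewrite /mxtrace mulr_suml; apply: eq_bigr => a _; rewrite mulr_sumr.
apply: eq_bigr => b _; rewrite -/(mxtrace _) -!mulmxA mxtrace_delta_mul.
rewrite mxE (bigD1 a) //= big1 => [|c ca]; last first.
  by rewrite mxE big1 ?mulr0 // => d _; rewrite mxE (negbTE ca) mul0r.
rewrite addr0; congr (_ * _); rewrite mxE (bigD1 b) //= mxE !eqxx mul1r.
by rewrite big1 ?addr0 // => c cb; rewrite mxE (negbTE cb) andbF mul0r.
Qed.

Lemma contract_out A B :
  \sum_a \sum_b \tr (E b a *m A) * \tr (E a b *m B) = \tr (A *m B).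
Proof.
apply: eq_bigr => a _; rewrite mxE; apply: eq_bigr => b _.
by rewrite !mxtrace_delta_mul.
Qed.

Lemma contract_in_tr A B :
  \sum_a \sum_b \tr (E b a *m A *m E b a *m B) = \tr (A *m B^T).
Proof.
apply: eq_bigr => a _; rewrite mxE; apply: eq_bigr => b _.
rewrite -!mulmxA mxtrace_delta_mul [in RHS]mxE.
rewrite mxE (bigD1 b) //= big1 => [|c ca]; last first.
  by rewrite mxE big1 ?mulr0 // => d _; rewrite mxE (negbTE ca) mul0r.
rewrite addr0; congr (_ * _); rewrite mxE (bigD1 a) //= mxE !eqxx mul1r.
by rewrite big1 ?addr0 // => c cb; rewrite mxE (negbTE cb) andbF mul0r.
Qed.

Lemma contract_out_tr A B :
  \sum_a \sum_b \tr (E b a *m A) * \tr (E b a *m B) = \tr (A *m B^T).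
Proof.
apply: eq_bigr => a _; rewrite mxE; apply: eq_bigr => b _.
by rewrite !mxtrace_delta_mul [B^T _ _]mxE.
Qed.

(* The left-invariant frame P E_ab P^-1 gives the same contractions, because
   the tensor sum of E_ab and E_ba is invariant under conjugation. *)
Section Conjugated.
Variables (P P' : 'M[K]_N).
Hypothesis PP' : P *m P' = 1%:M.

Lemma conj_contract_in A B :
  \sum_a \sum_b \tr (P *m E b a *m P' *m A *m (P *m E a b *m P') *m B) =
  \tr A * \tr B.
Proof.
have tc M : \tr (P' *m M *m P) = \tr M by rewrite -mulmxA mxtrace_mulC -mulmxA PP' mulmx1.
rewrite -[\tr A]tc -[\tr B]tc -contract_in.
apply: eq_bigr => a _; apply: eq_bigr => b _.
by rewrite -!mulmxA mxtrace_mulC -!mulmxA.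
Qed.

Lemma conj_contract_out A B :
  \sum_a \sum_b \tr (P *m E b a *m P' *m A) * \tr (P *m E a b *m P' *m B) =
  \tr (A *m B).
Proof.
transitivity (\tr ((P' *m A *m P) *m (P' *m B *m P))); last first.
  rewrite !mulmxA -(mulmxA _ P P') PP' mulmx1.
  by rewrite mxtrace_mulC !mulmxA PP' mul1mx.
rewrite -contract_out; apply: eq_bigr => a _; apply: eq_bigr => b _.
by congr (_ * _); rewrite -!mulmxA mxtrace_mulC -!mulmxA.
Qed.

Hypothesis PT : P' = P^T.

Lemma conj_contract_in_tr A B :
  \sum_a \sum_b \tr (P *m E b a *m P' *m A *m (P *m E b a *m P') *m B) =
  \tr (A *m B^T).
Proof.
transitivity (\tr ((P' *m A *m P) *m (P' *m B *m P)^T)); last first.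
  rewrite !trmx_mul PT trmxK !mulmxA -(mulmxA _ P P^T) -PT PP' mulmx1.
  by rewrite mxtrace_mulC !mulmxA PP' mul1mx.
rewrite -contract_in_tr; apply: eq_bigr => a _; apply: eq_bigr => b _.
by rewrite -!mulmxA mxtrace_mulC -!mulmxA.
Qed.

Lemma conj_contract_out_tr A B :
  \sum_a \sum_b \tr (P *m E b a *m P' *m A) * \tr (P *m E b a *m P' *m B) =
  \tr (A *m B^T).
Proof.
transitivity (\tr ((P' *m A *m P) *m (P' *m B *m P)^T)); last first.
  rewrite !trmx_mul PT trmxK !mulmxA -(mulmxA _ P P^T) -PT PP' mulmx1.
  by rewrite mxtrace_mulC !mulmxA PP' mul1mx.
rewrite -contract_out_tr; apply: eq_bigr => a _; apply: eq_bigr => b _.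
by congr (_ * _); rewrite -!mulmxA mxtrace_mulC -!mulmxA.
Qed.

End Conjugated.
End Contraction.

(** * The string operations as sums over occurrences *)

Section Families.
Variables (L : finite_graph) (V : zmodType) (phi : string L -> V).
Variables (P : seq (seq (oedge L))) (s : string L) (i : nat) (e : oedge L).
Variables (A B : seq (oedge L)).
Hypothesis si : loop_at s i = A ++ e :: B.
Let j := size A.

Let takeA k l : (k < size A)%N -> take k (A ++ l) = take k A.
Proof. by move=> kA; rewrite takel_cat 1?ltnW. Qed.

Let takeB k : take (size A + k.+1) (A ++ e :: B) = A ++ e :: take k B.
Proof. by rewrite take_cat ltnNge leq_addr addKn. Qed.

Let dropB k : drop (size A + k.+1).+1 (A ++ e :: B) = drop k.+1 B.
Proof. by rewrite drop_cat ltnNge leqW ?leq_addr //= -addnS addKn. Qed.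

Let takeE : take (size A) (A ++ e :: B) = A.
Proof. by rewrite takel_cat // take_size. Qed.

Let dropE : drop (size A).+1 (A ++ e :: B) = B.
Proof. by rewrite drop_cat ltnNge leqnSn subSnn /= drop0. Qed.

Let dropAB (l : seq (oedge L)) : drop (size A).+1 (A ++ e :: l) = l.
Proof. by rewrite drop_cat ltnNge leqnSn subSnn /= drop0. Qed.

Let lejB k : ((size A <= size A + k.+1)%N = true) * ((size A < size A + k.+1)%N = true).
Proof. by rewrite leq_addr addnS ltnS leq_addr. Qed.

Lemma sum_split_pos :
  \sum_(s' <- split_pos e i j s) phi s' =
  osum e A (fun C D => phi (replace s i [:: C ++ e :: B; rcons D e])) +
  osum e B (fun C D => phi (replace s i [:: A ++ e :: D; rcons C e])).
Proof.
rewrite /split_pos big_map si occ_sum_others; congr (_ + _).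
  apply: eq_big_seq => k /occ_lt kA; rewrite /j (minn_idPr (ltnW kA)) (maxn_idPl (ltnW kA)).
  by rewrite /bef /aft /btw takeA // dropE takeE !cats1.
apply: eq_big_seq => k _; rewrite /j (minn_idPl _) ?leq_addr // (maxn_idPr _) ?leq_addr //.
by rewrite /bef /aft /btw takeE dropB takeB dropAB cats1.
Qed.

Lemma sum_split_neg :
  \sum_(s' <- split_neg e i j s) phi s' =
  osum (oinv e) A (fun C D => phi (replace s i [:: C ++ B; D])) +
  osum (oinv e) B (fun C D => phi (replace s i [:: A ++ D; C])).
Proof.
rewrite /split_neg big_map si occ_sum_oinv; congr (_ + _).
  apply: eq_big_seq => k /occ_lt kA; rewrite /j (minn_idPr (ltnW kA)) (maxn_idPl (ltnW kA)).
  by rewrite /bef /aft /btw takeA // dropE takeE.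
apply: eq_big_seq => k _; rewrite /j (minn_idPl _) ?leq_addr // (maxn_idPr _) ?leq_addr //.
by rewrite /bef /aft /btw takeE dropB takeB dropAB.
Qed.

Lemma sum_twist_pos :
  \sum_(s' <- twist_pos e i j s) phi s' =
  osum (oinv e) A (fun C D =>
    phi (replace s i [:: C ++ oinv e :: revp D ++ e :: B])) +
  osum (oinv e) B (fun C D =>
    phi (replace s i [:: A ++ e :: revp C ++ oinv e :: D])).
Proof.
rewrite /twist_pos big_map si occ_sum_oinv; congr (_ + _).
  apply: eq_big_seq => k /occ_lt kA; rewrite /j ltnNge (ltnW kA) /=.
  by rewrite /bef /aft /btw takeA // dropE takeE.
by apply: eq_big_seq => k _; rewrite /j lejB /bef /aft /btw takeE dropB takeB dropAB.
Qed.

Lemma sum_twist_neg :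
  \sum_(s' <- twist_neg e i j s) phi s' =
  osum e A (fun C D => phi (replace s i [:: C ++ revp D ++ B])) +
  osum e B (fun C D => phi (replace s i [:: A ++ revp C ++ D])).
Proof.
rewrite /twist_neg big_map si occ_sum_others; congr (_ + _).
  apply: eq_big_seq => k /occ_lt kA; rewrite /j ltnNge (ltnW kA) /=.
  by rewrite /bef /aft /btw takeA // dropE takeE.
by apply: eq_big_seq => k _; rewrite /j lejB /bef /aft /btw takeE dropB takeB dropAB.
Qed.

Lemma sum_mergeU_pos :
  \sum_(s' <- mergeU_pos e i j s) phi s' =
  \sum_(r <- others s i) osum e (loop_at s r) (fun C D =>
    phi (replace2 s i r (A ++ e :: D ++ C ++ e :: B))).
Proof. by rewrite /mergeU_pos big_allpairs_dep /bef /aft si takeE dropE. Qed.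

Lemma sum_mergeU_neg :
  \sum_(s' <- mergeU_neg e i j s) phi s' =
  \sum_(r <- others s i) osum (oinv e) (loop_at s r) (fun C D =>
    phi (replace2 s i r (A ++ D ++ C ++ B))).
Proof. by rewrite /mergeU_neg big_allpairs_dep /bef /aft si takeE dropE. Qed.

Lemma sum_merge_pos :
  \sum_(s' <- merge_pos e i j s) phi s' =
  \sum_(s' <- mergeU_pos e i j s) phi s' +
  \sum_(r <- others s i) osum (oinv e) (loop_at s r) (fun C D =>
    phi (replace2 s i r (A ++ e :: revp C ++ revp D ++ e :: B))).
Proof.
by rewrite /merge_pos big_cat big_allpairs_dep /bef /aft si takeE dropE.
Qed.

Lemma sum_merge_neg :
  \sum_(s' <- merge_neg e i j s) phi s' =
  \sum_(s' <- mergeU_neg e i j s) phi s' +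
  \sum_(r <- others s i) osum e (loop_at s r) (fun C D =>
    phi (replace2 s i r (A ++ revp C ++ revp D ++ B))).
Proof.
by rewrite /merge_neg big_cat big_allpairs_dep /bef /aft si takeE dropE.
Qed.

Lemma sum_deform_pos :
  \sum_(s' <- deform_pos P e i j s) phi s' =
  \sum_(p <- P) osum e p (fun C D =>
    phi (replace s i [:: A ++ e :: D ++ C ++ e :: B])).
Proof. by rewrite /deform_pos big_allpairs_dep /bef /aft si takeE dropE. Qed.

Lemma sum_deform_neg :
  \sum_(s' <- deform_neg P e i j s) phi s' =
  \sum_(p <- P) osum (oinv e) p (fun C D =>
    phi (replace s i [:: A ++ D ++ C ++ B])).
Proof. by rewrite /deform_neg big_allpairs_dep /bef /aft si takeE dropE. Qed.

Lemma sum_expand_pos :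
  \sum_(s' <- expand_pos P e s) phi s' =
  \sum_(p <- P) phi (rcons s p) *+ count_mem (oinv e) p.
Proof.
rewrite /expand_pos big_allpairs_dep; apply: eq_bigr => p _.
exact: (osum_const (oinv e) p).
Qed.

Lemma sum_expand_neg :
  \sum_(s' <- expand_neg P e s) phi s' =
  \sum_(p <- P) phi (rcons s p) *+ count_mem e p.
Proof.
rewrite /expand_neg big_allpairs_dep; apply: eq_bigr => p _.
exact: (osum_const e p).
Qed.

End Families.

(** * Reversal of plaquettes *)

Section Reversal.
Variable L : finite_graph.
Implicit Types (p q l : seq (oedge L)) (P : seq (seq (oedge L))) (e : oedge L).

Lemma revp_cons x l : revp (x :: l) = rcons (revp l) (oinv x).
Proof. by rewrite /revp /= rev_cons. Qed.

Lemma revp_cat l1 l2 : revp (l1 ++ l2) = revp l2 ++ revp l1.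
Proof. by rewrite /revp map_cat rev_cat. Qed.

Lemma revpK : involutive (@revp L).
Proof.
by move=> l; rewrite /revp map_rev revK -map_comp map_id_in // => x _ /=; rewrite oinvK.
Qed.

Lemma cyc_eqP p q :
  reflect (exists l1 l2, p = l1 ++ l2 /\ q = l2 ++ l1) (cyc_eq p q).
Proof.
apply: (iffP existsP) => [[n /eqP ->]|[l1 [l2 [-> ->]]]].
  by exists (take n p), (drop n p); rewrite cat_take_drop.
have lt : (size l1 < (size (l1 ++ l2)).+1)%N by rewrite size_cat ltnS leq_addr.
by exists (Ordinal lt); rewrite /= rot_size_cat.
Qed.

Lemma cyc_eq_refl p : cyc_eq p p.
Proof. by apply/cyc_eqP; exists [::], p; rewrite cats0. Qed.

Lemma cyc_eq_sym p q : cyc_eq p q -> cyc_eq q p.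
Proof. by move=> /cyc_eqP[l1 [l2 [-> ->]]]; apply/cyc_eqP; exists l2, l1. Qed.

Lemma cyc_eq_trans p q r : cyc_eq p q -> cyc_eq q r -> cyc_eq p r.
Proof.
move=> /existsP[[m mp] /= /eqP ->] /existsP[[k kp] /= /eqP ->].
have [c ->] : exists c, rot k (rot m p) = rot c p.
  by rewrite size_rot in kp; rewrite rot_add_mod //; eexists.
by apply/cyc_eqP; exists (take c p), (drop c p); rewrite cat_take_drop.
Qed.

Lemma cyc_eq_revp p q : cyc_eq p q -> cyc_eq (revp p) (revp q).
Proof.
move=> /cyc_eqP[l1 [l2 [-> ->]]]; apply/cyc_eqP; exists (revp l2), (revp l1).
by rewrite !revp_cat.
Qed.

(** Plaquettes are pairwise inequivalent and the reversal of each is equivalent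
    to one of them, so reversal permutes the finite set of plaquettes. *)
Lemma sum_plaquette_revp (V : zmodType) P (F : seq (oedge L) -> V) :
  plaquette_set P -> (forall p q, cyc_eq p q -> F p = F q) ->
  \sum_(p <- P) F (revp p) = \sum_(p <- P) F p.
Proof.
move=> [_ ineq closed] Fcyc.
have Puniq : uniq P.
  rewrite uniq_pairwise; apply: sub_pairwise ineq => p q; apply: contra => /eqP ->.
  exact: cyc_eq_refl.
have Pinj p q : p \in P -> q \in P -> cyc_eq p q -> p = q.
  elim: (P) ineq => //= r P' IH /andP[/allP rP' /IH {}IH].
  rewrite !inE => /predU1P[->|pP] /predU1P[->|qP] // pq; last exact: IH.
    by have := rP' _ qP; rewrite pq.
  by have := rP' _ pP; rewrite (cyc_eq_sym pq).
pose f p := nth [::] P (find (cyc_eq (revp p)) P).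
have fP p : p \in P -> (f p \in P) * cyc_eq (revp p) (f p).
  move=> /closed[q qP pq]; have hp : has (cyc_eq (revp p)) P by apply/hasP; exists q.
  by split; [rewrite mem_nth // -has_find | exact: nth_find].
rewrite big_seq; under eq_bigr => p pP do rewrite (Fcyc _ _ (fP p pP).2).
rewrite -big_seq -(big_map f predT F); apply: perm_big.
have finj : {in P &, injective f}.
  move=> p q pP qP pq; apply: Pinj => //.
  have := (fP p pP).2; rewrite pq => /cyc_eq_trans /(_ (cyc_eq_sym (fP q qP).2)).
  by move/cyc_eq_revp; rewrite !revpK.
have funiq : uniq (map f P) by rewrite map_inj_in_uniq.
apply: uniq_perm => //; apply: (uniq_min_size funiq _ _).2; last by rewrite size_map.
by move=> _ /mapP[p pP ->]; rewrite (fP p pP).1.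
Qed.

Lemma osum_revp (V : zmodType) e p (g : seq (oedge L) -> seq (oedge L) -> V) :
  osum e (revp p) g = osum (oinv e) p (fun C D => g (revp D) (revp C)).
Proof.
elim: p g => [|x p IH] g; first by rewrite !osum_nil.
rewrite revp_cons -cats1 osum_cat osum_cons osum_nil addr0 IH osum_cons addrC cats0.
congr (_ + _); first by rewrite -(inj_eq (can_inj (@oinvK L))) oinvK.
by apply: eq_osum => C D; rewrite revp_cons cats1.
Qed.

(** An occurrence of [e] in a plaquette becomes an occurrence of its inverse in
    the reversed one, and the cut-open word is unaffected by a rotation of the
    plaquette. *)
Lemma sum_osum_revp (V : zmodType) P e (h : seq (oedge L) -> V) :
  plaquette_set P ->
  \sum_(p <- P) osum (oinv e) p (fun C D => h (revp C ++ revp D)) =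
  \sum_(p <- P) osum e p (fun C D => h (D ++ C)).
Proof.
move=> plaqP; rewrite -(sum_plaquette_revp plaqP).
  apply: eq_bigr => p _; rewrite osum_revp oinvK.
  by apply: eq_osum => C D; rewrite !revpK.
move=> _ _ /cyc_eqP[l1 [l2 [-> ->]]]; rewrite !osum_cat addrC.
by congr (_ + _); apply: eq_osum => C D; rewrite !revp_cat catA.
Qed.

End Reversal.

(** * Holonomies and their derivatives *)

Section Holonomy.
Variables (L : finite_graph) (K : fieldType) (N : nat).
Variable U : oedge L -> 'M[K]_N.
Hypothesis UV : forall x, U x *m U (oinv x) = 1%:M.
Implicit Types (e x : oedge L) (l : seq (oedge L)) (s : string L) (X : 'M[K]_N).

Lemma VU x : U (oinv x) *m U x = 1%:M.
Proof. by rewrite -{2}[x]oinvK UV. Qed.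

Definition hol l : 'M[K]_N := \big[mulmx/1%:M]_(x <- l) U x.

Definition trh l : K := \tr (hol l).

Lemma hol_nil : hol [::] = 1%:M. Proof. exact: big_nil. Qed.

Lemma hol_cons x l : hol (x :: l) = U x *m hol l. Proof. exact: big_cons. Qed.

Lemma hol_cat l1 l2 : hol (l1 ++ l2) = hol l1 *m hol l2.
Proof.
elim: l1 => [|x l1 IH]; first by rewrite hol_nil mul1mx.
by rewrite cat_cons !hol_cons IH mulmxA.
Qed.

Lemma hol_rcons l x : hol (rcons l x) = hol l *m U x.
Proof. by rewrite -cats1 hol_cat hol_cons hol_nil mulmx1. Qed.

Lemma trh_cyc l1 l2 : trh (l1 ++ l2) = trh (l2 ++ l1).
Proof. by rewrite /trh !hol_cat mxtrace_mulC. Qed.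

Lemma trh_rcons l x : trh (rcons l x) = trh (x :: l).
Proof. by rewrite -cats1 trh_cyc. Qed.

(** The derivation of words of links that sends [U e] to [X *m U e] and
    leaves all edges other than [e] and its inverse fixed. *)
Fixpoint dhol e X l : 'M[K]_N :=
  if l is x :: l' then
    (if x == e then X *m U x
     else if x == oinv e then - (U x *m X) else 0) *m hol l' +
    U x *m dhol e X l'
  else 0.

Lemma dhol_osum e X l :
  dhol e X l =
  osum e l (fun C D => hol C *m X *m U e *m hol D) -
  osum (oinv e) l (fun C D => hol C *m U (oinv e) *m X *m hol D).
Proof.
elim: l => [|x l IH] /=; first by rewrite !osum_nil subr0.
rewrite IH !osum_cons hol_nil !mul1mx mulmxBr.
rewrite !(osum_raddf (mulmx (U x))).
rewrite opprD addrACA; congr (_ + _).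
  case: (altP (x =P e)) => [->|_]; first by rewrite oinv_neqC subr0.
  by rewrite sub0r; case: (altP (x =P oinv e)) => [->|_]; rewrite ?mulNmx // mul0mx oppr0.
by congr (_ - _); apply: eq_osum => C D /=; rewrite hol_cons !mulmxA.
Qed.

Lemma dhol_cat e X l1 l2 :
  dhol e X (l1 ++ l2) = dhol e X l1 *m hol l2 + hol l1 *m dhol e X l2.
Proof.
elim: l1 => [|x l1 IH] /=; first by rewrite mul0mx add0r hol_nil mul1mx.
by rewrite IH hol_cons hol_cat mulmxDl mulmxDr !mulmxA addrA.
Qed.

Lemma dhol_is_linear e l : linear (fun X => dhol e X l).
Proof.
move=> c X Y; elim: l => [|x l IH] /=; first by rewrite scaler0 addr0.
rewrite IH scalerDr !mulmxDr -!scalemxAr addrACA; congr (_ + _).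
rewrite (scalemxAl c) -mulmxDl; congr (_ *m _).
case: ifP => _; first by rewrite mulmxDl scalemxAl.
case: ifP => _; last by rewrite scaler0 addr0.
by rewrite opprD scalerN.
Qed.

(** Right multiplication of [U e] by a matrix is left multiplication by its
    conjugate, so the derivation for the inverse edge reduces to that for [e]. *)
Lemma dhol_oinv e X l :
  dhol (oinv e) X l = - dhol e (U e *m X *m U (oinv e)) l.
Proof.
elim: l => [|x l IH] /=; first by rewrite oppr0.
rewrite IH opprD mulmxN oinvK; congr (_ + _); rewrite -[RHS]mulNmx; congr (_ *m _).
case: (altP (x =P e)) => [->|_].
  by rewrite oinv_neqC -[_ *m U e]mulmxA VU mulmx1.
case: eqP => [->|_]; last by rewrite oppr0.
by rewrite opprK !mulmxA VU mul1mx.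
Qed.

(** In the scalar direction the derivative only counts occurrences with sign. *)
Lemma dhol1 e l :
  dhol e 1%:M l = ((count_mem e l)%:Z - (count_mem (oinv e) l)%:Z)%:~R *: hol l.
Proof.
elim: l => [|x l IH] /=; first by rewrite subrr scale0r.
rewrite IH !hol_cons -scalemxAr !PoszD.
rewrite mul1mx mulmx1 opprD [in RHS]addrACA [in RHS]intrD [RHS]scalerDl; congr (_ + _).
case: (altP (x =P e)) => [->|_].
  by rewrite oinv_neqC subr0 scale1r.
case: eqP => _; first by rewrite sub0r mulrNz scaleN1r mulNmx.
by rewrite subr0 scale0r mul0mx.
Qed.

Lemma mxtrace_mul_dhol M e X l :
  \tr (M *m dhol e X l) =
  osum e l (fun C D => \tr (M *m hol C *m X *m (U e *m hol D))) -
  osum (oinv e) l (fun C D => \tr (M *m hol C *m U (oinv e) *m X *m hol D)).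
Proof.
rewrite dhol_osum mulmxBr (osum_raddf (mulmx M)) (osum_raddf (mulmx M)).
rewrite (raddfB (@mxtrace K N)) (osum_raddf (@mxtrace K N)) (osum_raddf (@mxtrace K N)).
by congr (_ - _); apply: eq_osum => C D /=; rewrite !mulmxA.
Qed.

Lemma mxtrace_dhol e X l :
  \tr (dhol e X l) =
  osum e l (fun C D => \tr (X *m hol (e :: D ++ C))) -
  osum (oinv e) l (fun C D => \tr (X *m hol (D ++ rcons C (oinv e)))).
Proof.
rewrite -[dhol _ _ _]mul1mx mxtrace_mul_dhol; congr (_ - _); apply: eq_osum => C D.
  by rewrite mul1mx -mulmxA mxtrace_mulC hol_cons hol_cat !mulmxA.
by rewrite mul1mx -mulmxA mxtrace_mulC hol_cat hol_rcons !mulmxA.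
Qed.

(** * Contraction of the derivative over the elementary matrices *)

Section Location.
Variable e : oedge L.

(** Translation acts on the chosen orientation of a link from the left, hence on
    the other one from the right. The marked loop is therefore opened before the
    marked edge or after it, according to its orientation, so that the matrix Y
    meets X at the marked occurrence; [tw] conjugates back to the first case. *)
Definition osgn : K := if e.2 then 1 else -1.
Definition lderiv X l := dhol (e.1, true) X l.
Definition based w := if e.2 then e :: w else rcons w e.
Definition tw : 'M[K]_N := if e.2 then 1%:M else U e.
Definition twV : 'M[K]_N := if e.2 then 1%:M else U (oinv e).
Local Notation twist X := (tw *m X *m twV).

Lemma twK : tw *m twV = 1%:M.
Proof. by rewrite /tw /twV; case: ifP => _; rewrite ?mulmx1. Qed.

Lemma osgnK : osgn * osgn = 1.
Proof. by rewrite /osgn; case: ifP; rewrite ?mulr1 // mulrNN mulr1. Qed.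

Lemma lderiv_twist X l : lderiv X l = osgn *: dhol e (twist X) l.
Proof.
rewrite /lderiv /osgn /tw /twV; case: (e) => a [] /=.
  by rewrite mul1mx mulmx1 scale1r.
by rewrite -[(a, true)]/(oinv (a, false)) dhol_oinv scaleN1r.
Qed.

Lemma mxtrace_mul_based Y w :
  \tr (Y *m hol (based w)) = \tr (twist Y *m hol (e :: w)).
Proof.
rewrite /based /tw /twV; case: ifP => _; first by rewrite mul1mx mulmx1.
rewrite hol_rcons hol_cons !mulmxA -(mulmxA _ (U (oinv e))) VU mulmx1.
by rewrite mxtrace_mulC !mulmxA.
Qed.

(** The first term comes from the marked occurrence, the second from all others. *)
Lemma lderiv_based Y X w :
  \tr (Y *m lderiv X (based w)) =
  osgn * (if e.2 then \tr (Y *m X *m hol (e :: w))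
          else \tr (Y *m hol (rcons w e) *m X)) +
  osgn * \tr (twist Y *m U e *m dhol e (twist X) w).
Proof.
rewrite lderiv_twist -scalemxAr mxtraceZ -mulrDr; congr (_ * _).
rewrite /based /tw /twV; case: ifP => _.
  by rewrite !mul1mx !mulmx1 /= eqxx hol_cons mulmxDr mxtraceD !mulmxA.
rewrite -cats1 dhol_cat hol_cat /= eqxx hol_cons hol_nil !mulmx1 mulmx0 addr0.
rewrite mulmxDr mxtraceD addrC; congr (_ + _).
  by rewrite !mulmxA -(mulmxA _ (U (oinv e)) (U e)) VU mulmx1.
rewrite -(mulmxA _ (U (oinv e)) (U e)) VU mulmx1.
by rewrite mulmxA mxtrace_mulC !mulmxA.
Qed.

Local Notation E := (@delta_mx K N N).

(** Occurrences in the marked loop itself: the sum over the elementary matrices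
    cuts the loop at the marked edge and at the other occurrence. *)
Lemma contract_same w :
  \sum_a \sum_b \tr (E b a *m lderiv (E a b) (based w)) =
  osgn * (N%:R * trh (e :: w) +
    (osum e w (fun C D => trh (e :: C) * trh (e :: D)) -
     osum (oinv e) w (fun C D => trh C * trh D))).
Proof.
under eq_bigr do under eq_bigr do rewrite lderiv_based.
under eq_bigr do rewrite big_split /= -!mulr_sumr.
rewrite big_split /= -!mulr_sumr -mulrDr; congr (_ * (_ + _)).
  case: (boolP e.2) => _.
    rewrite -mxtrace1 -contract_in; apply: eq_bigr => a _.
    by apply: eq_bigr => b _; rewrite mulmx1.
  rewrite -trh_rcons mulrC -[X in _ * X]mxtrace1 -contract_in.
  by apply: eq_bigr => a _; apply: eq_bigr => b _; rewrite mulmx1.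
under eq_bigr do under eq_bigr do rewrite mxtrace_mul_dhol.
under eq_bigr do rewrite sumrB !exchange_osum.
rewrite sumrB !exchange_osum; congr (_ - _); apply: eq_osum => C D.
  rewrite /trh !hol_cons -(conj_contract_in twK).
  by apply: eq_bigr => a _; apply: eq_bigr => b _; rewrite !mulmxA.
have <- : \tr (U e *m hol C *m U (oinv e)) = trh C.
  by rewrite mxtrace_mulC mulmxA VU mul1mx.
rewrite /trh -(conj_contract_in twK).
by apply: eq_bigr => a _; apply: eq_bigr => b _; rewrite !mulmxA.
Qed.

(** Occurrences in a different word: the sum joins it to the marked loop. *)
Lemma contract_other w l :
  \sum_a \sum_b \tr (E b a *m hol (based w)) * \tr (lderiv (E a b) l) =
  osgn * (osum e l (fun C D => trh (e :: w ++ e :: D ++ C)) -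
          osum (oinv e) l (fun C D => trh (w ++ D ++ C))).
Proof.
under eq_bigr do under eq_bigr do
  rewrite lderiv_twist mxtraceZ mulrCA mxtrace_mul_based.
under eq_bigr do rewrite -mulr_sumr.
rewrite -mulr_sumr; congr (_ * _).
under eq_bigr do under eq_bigr do rewrite mxtrace_dhol mulrBr !mulr_osumr.
under eq_bigr do rewrite sumrB !exchange_osum.
rewrite sumrB !exchange_osum; congr (_ - _); apply: eq_osum => C D /=.
  by rewrite (conj_contract_out twK) -hol_cat.
rewrite (conj_contract_out twK) -hol_cat -/(trh _) -!rcons_cat trh_rcons.
by rewrite /trh cat_cons !hol_cons mulmxA VU mul1mx.
Qed.

Section Orthogonal.
Hypothesis UT : forall x, U (oinv x) = (U x)^T.

Lemma hol_revp l : hol (revp l) = (hol l)^T.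
Proof.
elim: l => [|x l IH]; first by rewrite hol_nil trmx1.
by rewrite /revp /= rev_cons hol_rcons IH hol_cons trmx_mul UT.
Qed.

Lemma twT : twV = tw^T.
Proof. by rewrite /tw /twV; case: ifP => _; rewrite ?trmx1. Qed.

(** With transposed matrices the loop is not cut: one of its two arcs is
    reversed instead. *)
Lemma contract_same_tr w :
  \sum_a \sum_b \tr (E b a *m lderiv (E b a) (based w)) =
  osgn * (trh (e :: w) +
    (osum e w (fun C D => trh (C ++ revp D)) -
     osum (oinv e) w (fun C D => trh (e :: C ++ oinv e :: revp D)))).
Proof.
under eq_bigr do under eq_bigr do rewrite lderiv_based.
under eq_bigr do rewrite big_split /= -!mulr_sumr.
rewrite big_split /= -!mulr_sumr -mulrDr; congr (_ * (_ + _)).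
  case: (boolP e.2) => _.
    rewrite /trh -mxtrace_tr -[_^T]mul1mx -contract_in_tr; apply: eq_bigr => a _.
    by apply: eq_bigr => b _; rewrite mulmx1.
  rewrite -trh_rcons /trh -[X in _ = \tr X]mulmx1 -[X in _ = \tr (_ *m X)]trmx1 -contract_in_tr.
  by apply: eq_bigr => a _; apply: eq_bigr => b _; rewrite mulmx1.
under eq_bigr do under eq_bigr do rewrite mxtrace_mul_dhol.
under eq_bigr do rewrite sumrB !exchange_osum.
rewrite sumrB !exchange_osum; congr (_ - _); apply: eq_osum => C D.
  transitivity (\tr (hol (e :: C) *m (hol (e :: D))^T)).
    rewrite -(conj_contract_in_tr twK twT) !hol_cons.
    by apply: eq_bigr => a _; apply: eq_bigr => b _; rewrite !mulmxA.
  rewrite -hol_revp -hol_cat -/(trh _) /revp /= rev_cons -rcons_cat -trh_rcons.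
  by rewrite /trh !hol_rcons -mulmxA VU mulmx1.
transitivity (\tr (hol (e :: rcons C (oinv e)) *m (hol D)^T)).
  rewrite -(conj_contract_in_tr twK twT) hol_cons hol_rcons.
  by apply: eq_bigr => a _; apply: eq_bigr => b _; rewrite !mulmxA.
by rewrite -hol_revp -hol_cat cat_cons cat_rcons.
Qed.

Lemma contract_other_tr w l :
  \sum_a \sum_b \tr (E b a *m hol (based w)) * \tr (lderiv (E b a) l) =
  osgn * (osum e l (fun C D => trh (w ++ revp C ++ revp D)) -
          osum (oinv e) l (fun C D => trh (e :: w ++ e :: revp C ++ revp D))).
Proof.
under eq_bigr do under eq_bigr do
  rewrite lderiv_twist mxtraceZ mulrCA mxtrace_mul_based.
under eq_bigr do rewrite -mulr_sumr.
rewrite -mulr_sumr; congr (_ * _).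
under eq_bigr do under eq_bigr do rewrite mxtrace_dhol mulrBr !mulr_osumr.
under eq_bigr do rewrite sumrB !exchange_osum.
rewrite sumrB !exchange_osum; congr (_ - _); apply: eq_osum => C D /=.
  rewrite (conj_contract_out_tr twK twT) -hol_revp -hol_cat -/(trh _).
  rewrite /revp /= rev_cons map_cat rev_cat -!rcons_cat -trh_rcons.
  by rewrite /trh !hol_rcons -mulmxA VU mulmx1.
rewrite (conj_contract_out_tr twK twT) -hol_revp -hol_cat -/(trh _).
by rewrite /revp map_cat map_rcons rev_cat rev_rcons oinvK.
Qed.

End Orthogonal.
End Location.

(** * The loop equations at a fixed configuration *)

Definition wil s : K := \prod_(l <- s) (N%:R^-1 * trh l).

Section Pointwise.
Hypothesis N0 : N%:R != 0 :> K.
Variables (P : seq (seq (oedge L))) (s : string L) (i : nat) (e : oedge L).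
Variables (A B : seq (oedge L)) (beta : K).
Hypothesis si : loop_at s i = A ++ e :: B.

Local Notation W l := (N%:R^-1 * trh l).
Local Notation w := (B ++ A).
Local Notation E := (@delta_mx K N N).
Local Notation n := (N%:R : K).

Definition rest : K := \prod_(r <- others s i) W (loop_at s r).
Definition rest2 r : K := \prod_(k <- others s i | k != r) W (loop_at s k).

(** The Boltzmann weight is a common factor of the derivative of the test
    function F_Y in the direction X, and is divided out here; the three terms
    differentiate the marked loop, the other loops and the exponent of the
    weight. *)
Definition grad X Y : K :=
  \tr (Y *m lderiv e X (based e w)) * rest +
  \tr (Y *m hol (based e w)) *
    (\sum_(r <- others s i) n^-1 * \tr (lderiv e X (loop_at s r)) * rest2 r) +
  \tr (Y *m hol (based e w)) * rest *
    (n * beta * \sum_(p <- P) \tr (lderiv e X p)).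

Let lt_is : (i < size s)%N.
Proof.
rewrite ltnNge; apply/negP => /(nth_default [::]); rewrite -/(loop_at s i) si.
by case: (A).
Qed.

Lemma othersE : others s i = iota 0 i ++ iota i.+1 (size s - i.+1).
Proof.
rewrite /others -[in LHS](subnKC lt_is) -addn1 -addnA iotaD filter_cat add0n.
rewrite add1n /= eqxx /= !addn1; congr (_ ++ _); apply/all_filterP/allP => r.
  by rewrite mem_iota /= => /ltn_eqF->.
by rewrite mem_iota => /andP[/gtn_eqF ->].
Qed.

Lemma others_uniq : uniq (others s i).
Proof. by rewrite filter_uniq ?iota_uniq. Qed.

Lemma big_others (T : Type) (idx : T) (op : Monoid.law idx)
    (F : seq (oedge L) -> T) :
  \big[op/idx]_(r <- others s i) F (loop_at s r) =
  op (\big[op/idx]_(l <- take i s) F l) (\big[op/idx]_(l <- drop i.+1 s) F l).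
Proof.
rewrite othersE big_cat -[in RHS](map_nth_iota0 [::] (ltnW lt_is)) big_map.
have <- : map (nth [::] s) (iota i.+1 (size s - i.+1)) = drop i.+1 s.
  by rewrite map_nth_iota ?subnKC // take_oversize // size_drop.
by rewrite big_map.
Qed.

Lemma wil_replace ls : wil (replace s i ls) = wil ls * rest.
Proof.
by rewrite /wil /replace !big_cat /= mulrCA /rest (big_others _ (fun l => W l)).
Qed.

Lemma wil_loop : wil s = W (A ++ e :: B) * rest.
Proof.
rewrite -[in LHS](cat_take_drop i s) (drop_nth [::] lt_is) -/(loop_at s i) si.
by rewrite -/(replace s i [:: A ++ e :: B]) wil_replace /wil big_seq1.
Qed.

Lemma wil_replace2 r l : r \in others s i ->
  wil (replace2 s i r l) = W l * rest2 r.
Proof.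
rewrite mem_filter => /andP[ri _].
rewrite /wil /replace2 big_map (bigD1_seq i) ?filter_uniq ?iota_uniq //=; last first.
  by rewrite mem_filter mem_iota eq_sym ri.
rewrite eqxx; congr (_ * _); rewrite /rest2 !big_filter_cond.
by apply: eq_big => k; [rewrite andbC | case/andP => _ /negbTE ->].
Qed.

Lemma wil_rcons p : wil (rcons s p) = wil s * W p.
Proof. by rewrite /wil -cats1 big_cat big_seq1. Qed.

Lemma eq_sum_others (F G : nat -> K) :
  (forall r, r \in others s i -> F r = G r) ->
  \sum_(r <- others s i) F r = \sum_(r <- others s i) G r.
Proof. by move=> FG; apply: eq_big_seq. Qed.

Lemma sum_grad (I : Type) (r : seq I) (X Y : I -> I -> 'M[K]_N) :
  \sum_(a <- r) \sum_(b <- r) grad (X a b) (Y a b) =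
  (\sum_(a <- r) \sum_(b <- r)
     \tr (Y a b *m lderiv e (X a b) (based e w))) * rest +
  \sum_(k <- others s i) n^-1 * rest2 k *
    (\sum_(a <- r) \sum_(b <- r)
      \tr (Y a b *m hol (based e w)) * \tr (lderiv e (X a b) (loop_at s k))) +
  rest * (n * beta) *
  \sum_(p <- P) \sum_(a <- r) \sum_(b <- r)
      \tr (Y a b *m hol (based e w)) * \tr (lderiv e (X a b) p).
Proof.
under eq_bigr do rewrite !big_split /=.
rewrite !big_split /=; congr (_ + _ + _).
- by rewrite mulr_suml; apply: eq_bigr => a _; rewrite mulr_suml.
- under [RHS]eq_bigr do rewrite mulr_sumr.
  rewrite [RHS]exchange_big; apply: eq_bigr => a _.
  under [RHS]eq_bigr do rewrite mulr_sumr.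
  rewrite [RHS]exchange_big; apply: eq_bigr => b _.
  by rewrite mulr_sumr; apply: eq_bigr => k _; ring.
rewrite [X in _ = _ * X]exchange_big /= mulr_sumr; apply: eq_bigr => a _.
rewrite [X in _ = _ * X]exchange_big /= mulr_sumr; apply: eq_bigr => b _.
by rewrite -mulr_sumr; ring.
Qed.

Local Notation t := (\sum_(l <- s) ((count_mem e l)%:Z - (count_mem (oinv e) l)%:Z)).

(** The factor N^-2 normalizes the two traces of a split loop; the product rule
    term at the marked occurrence carries a further N and yields the string
    itself. *)
Lemma pointwise_same :
  (n ^+ 2)^-1 * ((n * trh (e :: w) +
    (osum e w (fun C D => trh (e :: C) * trh (e :: D)) -
     osum (oinv e) w (fun C D => trh C * trh D))) * rest) =
  wil s + \sum_(s' <- split_pos e i (size A) s) wil s' -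
  \sum_(s' <- split_neg e i (size A) s) wil s'.
Proof.
rewrite (sum_split_pos _ si) (sum_split_neg _ si) wil_loop !osum_cat.
have two l1 l2 : wil (replace s i [:: l1; l2]) =
    (n ^+ 2)^-1 * (trh l1 * trh l2 * rest).
  by rewrite wil_replace /wil big_cons big_seq1 expr2 invfM; ring.
have cyc : trh (A ++ e :: B) = trh (e :: w) by rewrite trh_cyc.
rewrite mulrDl mulrDr -[RHS]addrA; congr (_ + _).
  by rewrite cyc; field.
rewrite mulrBl mulrBr !mulrDl !mulrDr !mulr_osuml !mulr_osumr.
congr (_ - _); rewrite addrC; congr (_ + _); apply: eq_osum => C D; rewrite two.
- by rewrite trh_rcons -cat_cons trh_cyc.
- by rewrite trh_rcons [trh (A ++ _)]trh_cyc; ring.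
- by rewrite trh_cyc.
- by rewrite [trh (A ++ _)]trh_cyc; ring.
Qed.

Lemma merge_eq r l l' : r \in others s i -> trh l = trh l' ->
  n^-1 * rest2 r * trh l = wil (replace2 s i r l').
Proof. by move=> ri ->; rewrite wil_replace2 // mulrAC. Qed.

Lemma deform_eq l l' : trh l = trh l' ->
  (n ^+ 2)^-1 * (rest * (n * beta) * trh l) = beta * wil (replace s i [:: l']).
Proof. by move=> ->; rewrite wil_replace /wil big_seq1; field. Qed.

Lemma pointwise_merge (f g : seq (oedge L) -> seq (oedge L) -> seq (oedge L))
    (f' g' : seq (oedge L) -> seq (oedge L) -> seq (oedge L)) x y :
  (forall C D, trh (f C D) = trh (f' C D)) ->
  (forall C D, trh (g C D) = trh (g' C D)) ->
  \sum_(r <- others s i) n^-1 * rest2 r *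
    (osum x (loop_at s r) (fun C D => trh (f C D)) -
     osum y (loop_at s r) (fun C D => trh (g C D))) =
  \sum_(r <- others s i) osum x (loop_at s r)
     (fun C D => wil (replace2 s i r (f' C D))) -
  \sum_(r <- others s i) osum y (loop_at s r)
     (fun C D => wil (replace2 s i r (g' C D))).
Proof.
move=> ff' gg'; rewrite -sumrB; apply: eq_sum_others => r ri.
rewrite mulrBr !mulr_osumr; congr (_ - _); apply: eq_osum => C D; exact: merge_eq.
Qed.

Lemma pointwise_deform (f g : seq (oedge L) -> seq (oedge L) -> seq (oedge L))
    (f' g' : seq (oedge L) -> seq (oedge L) -> seq (oedge L)) x y :
  (forall C D, trh (f C D) = trh (f' C D)) ->
  (forall C D, trh (g C D) = trh (g' C D)) ->
  (n ^+ 2)^-1 * (rest * (n * beta) * \sum_(p <- P)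
    (osum x p (fun C D => trh (f C D)) - osum y p (fun C D => trh (g C D)))) =
  beta * (\sum_(p <- P) osum x p (fun C D => wil (replace s i [:: f' C D]))) -
  beta * (\sum_(p <- P) osum y p (fun C D => wil (replace s i [:: g' C D]))).
Proof.
move=> ff' gg'; rewrite !mulr_sumr -sumrB; apply: eq_bigr => p _.
rewrite !mulrBr !mulr_osumr; congr (_ - _); apply: eq_osum => C D; exact: deform_eq.
Qed.

Local Notation c l := ((count_mem e l)%:Z - (count_mem (oinv e) l)%:Z).

Lemma mxtrace_lderiv1 l :
  osgn e * \tr (lderiv e 1%:M l) = (c l)%:~R * trh l.
Proof.
by rewrite lderiv_twist mulmx1 twK dhol1 !mxtraceZ mulrA osgnK mul1r.
Qed.

Lemma tcount_others : tcount e s = c (based e w) + \sum_(r <- others s i) c (loop_at s r).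
Proof.
rewrite /tcount -[in LHS](cat_take_drop i s) (drop_nth [::] lt_is) -/(loop_at s i) si.
rewrite big_cat big_cons /= addrCA; congr (_ + _).
  have ct a : count a (A ++ e :: B) = count a (based e w).
    rewrite /based; case: ifP => _; rewrite -?cats1 /= !count_cat /= ?addn0.
      by move: (count a A) (count a B) (nat_of_bool (a e)) => x y z; lia.
    by move: (count a A) (count a B) (nat_of_bool (a e)) => x y z; lia.
  by rewrite !ct.
by rewrite (big_others _ (fun l => c l)).
Qed.

Lemma trh_based : trh (based e w) = trh (e :: w).
Proof. by rewrite /based; case: ifP => _; rewrite ?trh_rcons. Qed.

(** The scalar direction: it multiplies the loops by their total signed count of
    the marked edge and the weight by the same count over plaquettes, whose trace
    is then a loop added to the string. *)
Lemma grad_scalar :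
  (n ^+ 2)^-1 * (osgn e * (n^-1 * grad 1%:M 1%:M)) =
  (tcount e s)%:~R / n ^+ 2 * wil s +
  beta * (\sum_(s' <- expand_neg P e s) wil s') -
  beta * (\sum_(s' <- expand_pos P e s) wil s').
Proof.
rewrite sum_expand_pos sum_expand_neg /grad !mul1mx -/(trh _) trh_based.
have -> : osgn e * (n^-1 * (\tr (lderiv e 1%:M (based e w)) * rest + trh (e :: w) *
   (\sum_(r <- others s i) n^-1 * \tr (lderiv e 1%:M (loop_at s r)) * rest2 r) +
   trh (e :: w) * rest * (n * beta * (\sum_(p <- P) \tr (lderiv e 1%:M p))))) =
   n^-1 * ((osgn e * \tr (lderiv e 1%:M (based e w))) * rest + trh (e :: w) *
   (\sum_(r <- others s i) n^-1 * (osgn e * \tr (lderiv e 1%:M (loop_at s r))) * rest2 r) +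
   trh (e :: w) * rest * (n * beta * (\sum_(p <- P) osgn e * \tr (lderiv e 1%:M p)))).
  rewrite -mulr_sumr.
  have -> : \sum_(r <- others s i) n^-1 * (osgn e * \tr (lderiv e 1%:M (loop_at s r))) * rest2 r =
     osgn e * \sum_(r <- others s i) n^-1 * \tr (lderiv e 1%:M (loop_at s r)) * rest2 r.
    by rewrite mulr_sumr; apply: eq_bigr => r _; ring.
  by ring.
rewrite mxtrace_lderiv1 trh_based.
have -> : \sum_(r <- others s i) n^-1 * (osgn e * \tr (lderiv e 1%:M (loop_at s r))) * rest2 r =
    (\sum_(r <- others s i) c (loop_at s r))%:~R * rest.
  rewrite (raddf_sum (intmul 1)) mulr_suml; apply: eq_big_seq => r ri.
  rewrite mxtrace_lderiv1 /rest (bigD1_seq r) ?others_uniq //=.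
  by rewrite -/(rest2 r); ring.
have -> : \sum_(p <- P) osgn e * \tr (lderiv e 1%:M p) = \sum_(p <- P) (c p)%:~R * trh p.
  by apply: eq_bigr => p _; rewrite mxtrace_lderiv1.
rewrite tcount_others intrD wil_loop.
have -> : trh (A ++ e :: B) = trh (e :: w) by rewrite trh_cyc.
rewrite -[RHS]addrA -[X in _ = _ + X]mulrBr -sumrB.
have -> : \sum_(p <- P) (wil (rcons s p) *+ count_mem e p -
      wil (rcons s p) *+ count_mem (oinv e) p) =
   n^-1 ^+ 2 * rest * trh (e :: w) * \sum_(p <- P) (c p)%:~R * trh p.
  rewrite mulr_sumr; apply: eq_bigr => p _.
  rewrite wil_rcons wil_loop trh_cyc cat_cons intrB -!pmulrn.
  by rewrite -[_ *+ count_mem e p]mulr_natr -[_ *+ count_mem (oinv e) p]mulr_natr; ring.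
by field.
Qed.

Lemma osgn_factor (a : K) (F : nat -> K) (G : seq (oedge L) -> K) :
  osgn e * (osgn e * a * rest +
    \sum_(r <- others s i) n^-1 * rest2 r * (osgn e * F r) +
    rest * (n * beta) * \sum_(p <- P) osgn e * G p) =
  a * rest + \sum_(r <- others s i) n^-1 * rest2 r * F r +
  rest * (n * beta) * \sum_(p <- P) G p.
Proof.
have -> : \sum_(r <- others s i) n^-1 * rest2 r * (osgn e * F r) =
          osgn e * \sum_(r <- others s i) n^-1 * rest2 r * F r.
  by rewrite mulr_sumr; apply: eq_bigr => r _; ring.
rewrite -mulr_sumr; have := osgnK e; move: (osgn e) => o oo.
set S := \sum_(r <- _) _; set S' := \sum_(p <- P) _.
transitivity ((o * o) * (a * rest + S + rest * (n * beta) * S')); first by ring.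
by rewrite oo mul1r.
Qed.

Let cyc_pos l : trh (e :: w ++ l) = trh (A ++ l ++ e :: B).
Proof. by rewrite -catA -cat_cons trh_cyc catA. Qed.

Let cyc_neg l : trh (w ++ l) = trh (A ++ l ++ B).
Proof. by rewrite -catA trh_cyc catA. Qed.

(** The left-hand side is the sum of [grad] over dual bases of sl(N): the scalar
    direction is subtracted from the sum over all elementary matrices. *)
Lemma loop_identity_sl :
  (n ^+ 2)^-1 * (osgn e *
    (\sum_a \sum_b grad (E a b) (E b a) - n^-1 * grad 1%:M 1%:M)) =
  (1 - (tcount e s)%:~R / n ^+ 2) * wil s +
  \sum_(s' <- split_pos e i (size A) s) wil s' -
  \sum_(s' <- split_neg e i (size A) s) wil s' +
  (n ^+ 2)^-1 * (\sum_(s' <- mergeU_pos e i (size A) s) wil s') -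
  (n ^+ 2)^-1 * (\sum_(s' <- mergeU_neg e i (size A) s) wil s') +
  beta * (\sum_(s' <- deform_pos P e i (size A) s) wil s') -
  beta * (\sum_(s' <- deform_neg P e i (size A) s) wil s') +
  beta * (\sum_(s' <- expand_pos P e s) wil s') -
  beta * (\sum_(s' <- expand_neg P e s) wil s').
Proof.
rewrite sum_grad contract_same mulrBr mulrBr grad_scalar.
under [\sum_(k <- others s i) _]eq_bigr do rewrite contract_other.
under [\sum_(p <- P) \sum_a _]eq_bigr do rewrite contract_other.
rewrite osgn_factor.
rewrite (@pointwise_merge _ _ (fun C D => A ++ e :: D ++ C ++ e :: B)
  (fun C D => A ++ D ++ C ++ B)); first last.
- by move=> C D; rewrite cyc_neg -!catA.
- by move=> C D; rewrite cyc_pos /= -!catA.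
rewrite !mulrDr pointwise_same.
rewrite (@pointwise_deform _ _ (fun C D => A ++ e :: D ++ C ++ e :: B)
  (fun C D => A ++ D ++ C ++ B)); first last.
- by move=> C D; rewrite cyc_neg -!catA.
- by move=> C D; rewrite cyc_pos /= -!catA.
rewrite (sum_mergeU_pos _ si) (sum_mergeU_neg _ si).
rewrite (sum_deform_pos _ _ si) (sum_deform_neg _ _ si); ring.
Qed.

Section Orthogonal.
Hypothesis UT : forall x, U (oinv x) = (U x)^T.
Hypothesis plaqP : plaquette_set P.

Lemma trh_revp l : trh (revp l) = trh l.
Proof. by rewrite /trh hol_revp // mxtrace_tr. Qed.

Lemma pointwise_same_tr :
  (n ^+ 2)^-1 * ((trh (e :: w) +
    (osum e w (fun C D => trh (C ++ revp D)) -
     osum (oinv e) w (fun C D => trh (e :: C ++ oinv e :: revp D)))) * rest) =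
  n^-1 * wil s + n^-1 * (\sum_(s' <- twist_neg e i (size A) s) wil s') -
  n^-1 * (\sum_(s' <- twist_pos e i (size A) s) wil s').
Proof.
rewrite (sum_twist_pos _ si) (sum_twist_neg _ si) wil_loop !osum_cat.
have one l : n^-1 * wil (replace s i [:: l]) = (n ^+ 2)^-1 * (trh l * rest).
  by rewrite wil_replace /wil big_seq1 expr2 invfM; ring.
have cyc : trh (A ++ e :: B) = trh (e :: w) by rewrite trh_cyc.
rewrite mulrDl mulrDr -[RHS]addrA; congr (_ + _).
  by rewrite cyc; field.
rewrite mulrBl mulrBr !mulrDl !mulrDr !mulr_osuml !mulr_osumr.
congr (_ - _); rewrite addrC; congr (_ + _); apply: eq_osum => C D; rewrite one.
- by rewrite -catA trh_cyc -catA.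
- by rewrite -trh_revp // revp_cat revpK -catA trh_cyc -catA.
- by rewrite -catA -cat_cons trh_cyc -catA.
rewrite -trh_revp // revp_cons revp_cat revp_cons revpK oinvK.
by rewrite -!cats1 -!catA trh_cyc -!catA.
Qed.

(** The bracket is minus the sum of [grad] D D over D = E_ab - E_ba, a < b. The
    terms with E_ba in both places produce transposed pieces; transposition turns
    a holonomy into that of the reversed word, which gives the twistings and the
    additional mergers and deformations. *)
Lemma loop_identity_so :
  (n ^+ 2)^-1 * (osgn e *
    (\sum_a \sum_b grad (E a b) (E b a) - \sum_a \sum_b grad (E b a) (E b a))) =
  (1 - n^-1) * wil s +
  \sum_(s' <- split_pos e i (size A) s) wil s' -
  \sum_(s' <- split_neg e i (size A) s) wil s' +
  (n ^+ 2)^-1 * (\sum_(s' <- merge_pos e i (size A) s) wil s') -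
  (n ^+ 2)^-1 * (\sum_(s' <- merge_neg e i (size A) s) wil s') +
  n^-1 * (\sum_(s' <- twist_pos e i (size A) s) wil s') -
  n^-1 * (\sum_(s' <- twist_neg e i (size A) s) wil s') +
  2 * beta * (\sum_(s' <- deform_pos P e i (size A) s) wil s') -
  2 * beta * (\sum_(s' <- deform_neg P e i (size A) s) wil s').
Proof.
rewrite !sum_grad contract_same contract_same_tr // mulrBr mulrBr.
under [\sum_(k <- others s i) _]eq_bigr do rewrite contract_other.
under [\sum_(p <- P) \sum_a _]eq_bigr do rewrite contract_other.
under [X in _ - _ * (_ * (_ + X + _))]eq_bigr do rewrite contract_other_tr //.
under [X in _ - _ * (_ * (_ + _ * X))]eq_bigr do rewrite contract_other_tr //.
rewrite !osgn_factor.
rewrite (@pointwise_merge _ _ (fun C D => A ++ e :: D ++ C ++ e :: B)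
  (fun C D => A ++ D ++ C ++ B)); first last.
- by move=> C D; rewrite cyc_neg -!catA.
- by move=> C D; rewrite cyc_pos /= -!catA.
rewrite (@pointwise_merge _ _ (fun C D => A ++ revp C ++ revp D ++ B)
  (fun C D => A ++ e :: revp C ++ revp D ++ e :: B)); first last.
- by move=> C D; rewrite cyc_pos /= -!catA.
- by move=> C D; rewrite cyc_neg -!catA.
rewrite !mulrDr pointwise_same pointwise_same_tr.
rewrite (@pointwise_deform _ _ (fun C D => A ++ e :: D ++ C ++ e :: B)
  (fun C D => A ++ D ++ C ++ B)); first last.
- by move=> C D; rewrite cyc_neg -!catA.
- by move=> C D; rewrite cyc_pos /= -!catA.
rewrite (@pointwise_deform _ _ (fun C D => A ++ revp C ++ revp D ++ B)
  (fun C D => A ++ e :: revp C ++ revp D ++ e :: B)); first last.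
- by move=> C D; rewrite cyc_pos /= -!catA.
- by move=> C D; rewrite cyc_neg -!catA.
have -> : \sum_(p <- P) osum e p
      (fun C D => wil (replace s i [:: A ++ revp C ++ revp D ++ B])) =
    \sum_(s' <- deform_neg P e i (size A) s) wil s'.
  rewrite (sum_deform_neg _ _ si).
  have := sum_osum_revp (oinv e) (fun l => wil (replace s i [:: A ++ l ++ B])) plaqP.
  rewrite oinvK; congr (_ = _); apply: eq_bigr => p _; apply: eq_osum => C D;
    by rewrite -!catA.
have -> : \sum_(p <- P) osum (oinv e) p
      (fun C D => wil (replace s i [:: A ++ e :: revp C ++ revp D ++ e :: B])) =
    \sum_(s' <- deform_pos P e i (size A) s) wil s'.
  rewrite (sum_deform_pos _ _ si).
  have := sum_osum_revp e (fun l => wil (replace s i [:: A ++ e :: l ++ e :: B])) plaqP.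
  congr (_ = _); apply: eq_bigr => p _; apply: eq_osum => C D; by rewrite -!catA.
rewrite (sum_merge_pos _ si) (sum_merge_neg _ si).
rewrite (sum_mergeU_pos _ si) (sum_mergeU_neg _ si).
rewrite (sum_deform_pos _ _ si) (sum_deform_neg _ _ si); ring.
Qed.

End Orthogonal.
End Pointwise.

End Holonomy.

(** * Integrals of bounded complex functions *)

Import numFieldNormedType.Exports.
Local Open Scope classical_set_scope.

Local Notation Re := (@complex.Re _).
Local Notation Im := (@complex.Im _).

Section ComplexParts.
Variable R : realType.
Implicit Types z : R[i].

Lemma ReD z z' : Re (z + z') = Re z + Re z'. Proof. by case: z z' => [? ?] []. Qed.
Lemma ImD z z' : Im (z + z') = Im z + Im z'. Proof. by case: z z' => [? ?] []. Qed.
Lemma ReM z z' : Re (z * z') = Re z * Re z' - Im z * Im z'.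
Proof. by case: z z' => [? ?] []. Qed.
Lemma ImM z z' : Im (z * z') = Re z * Im z' + Im z * Re z'.
Proof. by case: z z' => [? ?] []. Qed.

Lemma normRe z : `|Re z|%:C <= `|z|. Proof. exact: normc_ge_Re. Qed.

Lemma normImi : `|'i%C| = 1 :> R[i].
Proof. by rewrite normc_def /= expr0n expr1n add0r sqrtr1. Qed.

Lemma normIm z : `|Im z|%:C <= `|z|.
Proof.
rewrite -[Im z]opprK -ReiNIm normrN; apply: le_trans (normRe _) _.
by rewrite normrM normImi mulr1.
Qed.

Lemma normC_real (x : R) : `|x%:C| = `|x|%:C.
Proof. by rewrite normc_def /= expr0n addr0 sqrtr_sqr. Qed.

Lemma norm_le_parts z (M : R) : `|Re z| <= M -> `|Im z| <= M -> `|z| <= (2 * M)%:C.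
Proof.
move=> rM iM; rewrite [z in `|z|]complexE; apply: le_trans (ler_normD _ _) _.
rewrite normrM normImi mul1r !normC_real -rmorphD lecR mulr_natl mulr2n.
exact: lerD.
Qed.

End ComplexParts.

Section BoundedMeasurable.
Context d (T : measurableType d) (R : realType).
Implicit Types (f g : T -> R[i]) (c : R[i]).

Definition bounded_mfun f :=
  [/\ measurable_fun setT (Re \o f), measurable_fun setT (Im \o f) &
      exists M : R, forall x, `|f x| <= M%:C].

Lemma eq_bmf f g : f =1 g -> bounded_mfun f -> bounded_mfun g.
Proof. by move=> /funext ->. Qed.

Lemma bmf_cst c : bounded_mfun (fun=> c).
Proof.
split; try exact: measurable_cst.
by exists (Re `|c|) => _; rewrite RRe_real // normr_real.
Qed.

Lemma bmfD f g : bounded_mfun f -> bounded_mfun g -> bounded_mfun (fun x => f x + g x).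
Proof.
move=> [rf jf [M fM]] [rg jg [M' gM]]; split.
- rewrite (_ : _ \o _ = (Re \o f) \+ (Re \o g)); first exact: measurable_funD.
  by apply/funext => x; rewrite /= ReD.
- rewrite (_ : _ \o _ = (Im \o f) \+ (Im \o g)); first exact: measurable_funD.
  by apply/funext => x; rewrite /= ImD.
exists (M + M') => x; rewrite rmorphD; apply: le_trans (ler_normD _ _) _.
exact: lerD.
Qed.

Lemma bmfM f g : bounded_mfun f -> bounded_mfun g -> bounded_mfun (fun x => f x * g x).
Proof.
move=> [rf jf [M fM]] [rg jg [M' gM]]; split.
- rewrite (_ : _ \o _ = ((Re \o f) \* (Re \o g)) \- ((Im \o f) \* (Im \o g))).
    by apply: measurable_funB; exact: measurable_funM.
  by apply/funext => x; rewrite /= ReM.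
- rewrite (_ : _ \o _ = ((Re \o f) \* (Im \o g)) \+ ((Im \o f) \* (Re \o g))).
    by apply: measurable_funD; exact: measurable_funM.
  by apply/funext => x; rewrite /= ImM.
by exists (M * M') => x; rewrite rmorphM normrM ler_pM.
Qed.

Lemma bmfZ c f : bounded_mfun f -> bounded_mfun (fun x => c * f x).
Proof. by move=> bf; apply: bmfM => //; exact: bmf_cst. Qed.

Lemma bmfN f : bounded_mfun f -> bounded_mfun (fun x => - f x).
Proof.
by move=> /(bmfZ (-1)); congr bounded_mfun; apply/funext => x; rewrite mulN1r.
Qed.

Lemma bmf_sum (I : Type) (r : seq I) (F : I -> T -> R[i]) :
  (forall i, bounded_mfun (F i)) -> bounded_mfun (fun x => \sum_(i <- r) F i x).
Proof.
move=> bF; elim: r => [|i r IH].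
  by under eq_fun do rewrite big_nil; exact: bmf_cst.
by under eq_fun do rewrite big_cons; exact: bmfD.
Qed.

Lemma bmf_prod (I : Type) (r : seq I) (p : pred I) (F : I -> T -> R[i]) :
  (forall i, bounded_mfun (F i)) -> bounded_mfun (fun x => \prod_(i <- r | p i) F i x).
Proof.
move=> bF; elim: r => [|i r IH].
  by under eq_fun do rewrite big_nil; exact: bmf_cst.
under eq_fun do rewrite big_cons; case: (p i) => //; exact: bmfM.
Qed.

Variable nu : probability T R.

Lemma bounded_integrable (f : T -> R) (M : R) :
  measurable_fun setT f -> (forall x, `|f x| <= M) -> nu.-integrable setT (EFin \o f).
Proof.
move=> mf fM; apply: measurable_bounded_integrable => //.
  by rewrite [X in (X < _)%E]probability_setT ltry.
exists M; split; first exact: num_real.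
by move=> y /ltW My x _; exact: le_trans (fM x) My.
Qed.

Lemma bmf_integrable f : bounded_mfun f ->
  (nu.-integrable setT (EFin \o (Re \o f))) * (nu.-integrable setT (EFin \o (Im \o f))).
Proof.
move=> [rf jf [M fM]]; split; apply: (@bounded_integrable _ M) => // x /=.
  by rewrite -lecR; exact: le_trans (normRe _) (fM x).
by rewrite -lecR; exact: le_trans (normIm _) (fM x).
Qed.

Local Notation I := (cintegral nu).

Lemma cintegralD f g : bounded_mfun f -> bounded_mfun g ->
  I (fun x => f x + g x) = I f + I g.
Proof.
move=> /bmf_integrable[rf jf] /bmf_integrable[rg jg].
rewrite /cintegral; under eq_Rintegral do rewrite ReD.
under [X in _ +i* X]eq_Rintegral do rewrite ImD.
by rewrite !RintegralD.
Qed.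

Lemma cintegralZ c f : bounded_mfun f -> I (fun x => c * f x) = c * I f.
Proof.
move=> /bmf_integrable[rf jf].
have intZ (k : R) (h : T -> R) : nu.-integrable setT (EFin \o h) ->
    nu.-integrable setT (EFin \o (fun x => k * h x)).
  by move=> ih; have := integrableZl measurableT k ih; congr (integrable _ _ _).
rewrite /cintegral; under eq_Rintegral do rewrite ReM.
under [X in _ +i* X]eq_Rintegral do rewrite ImM.
rewrite RintegralB ?RintegralD ?RintegralZl //; try exact: intZ.
by case: c => a b.
Qed.

Lemma cintegral_sum (J : Type) (r : seq J) (F : J -> T -> R[i]) :
  (forall j, bounded_mfun (F j)) ->
  I (fun x => \sum_(j <- r) F j x) = \sum_(j <- r) I (F j).
Proof.
move=> bF; elim: r => [|j r IH].
  under eq_fun do rewrite big_nil; rewrite big_nil.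
  rewrite -[X in I (fun=> X)](mul0r 0) cintegralZ ?mul0r //; exact: bmf_cst.
rewrite big_cons -IH -cintegralD //; last exact: bmf_sum.
by congr (cintegral _ _); apply/funext => x; rewrite big_cons.
Qed.

Lemma norm_cintegral f (M : R) : bounded_mfun f -> (forall x, `|f x| <= M%:C) ->
  `|I f| <= (2 * M)%:C.
Proof.
move=> bf fM; have [rf jf] := bmf_integrable bf; have [mr mi _] := bf.
have bound (h : T -> R) : measurable_fun setT h -> (forall x, `|h x| <= M) ->
    `|Rintegral nu setT h| <= M.
  move=> mh hM; have ih := bounded_integrable mh hM.
  apply: le_trans (le_normr_Rintegral measurableT ih) _.
  have -> : M = Rintegral nu setT (fun=> M).
    by rewrite Rintegral_cst // [X in fine X](@probability_setT _ _ _ nu) mulr1.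
  apply: le_Rintegral => //.
    by apply: (@bounded_integrable _ M) => [|x]; rewrite ?normr_id //; exact: measurableT_comp.
  by apply: (@bounded_integrable _ `|M|).
apply: norm_le_parts; apply: bound => // x /=.
  by rewrite -lecR; exact: le_trans (normRe _) (fM x).
by rewrite -lecR; exact: le_trans (normIm _) (fM x).
Qed.

End BoundedMeasurable.

(** * Invariance of the product measure under translation of a link *)

Section Translation.
Variables (K : numFieldType) (N : nat) (G : matrix_group K N) (E : finType).
Variable R : realType.
Implicit Types (g h : gelt G) (a b : E) (Q : gconfig G E).

Lemma continuous_borel (h : gelt G -> R) :
  continuous h -> measurable_fun setT (h : gborel G -> R).
Proof.
move=> /continuousP ch.
apply: (measurability _ (RGenOpens.measurableE R)) => _ [_ [x [y ->]] <-].
rewrite setTI; apply: sub_sigma_algebra; apply: ch; exact: interval_open.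
Qed.

Lemma entry_continuous k l : continuous (fun g : gelt G => val g k l).
Proof.
move=> g; apply: (@continuous_comp _ _ _ (fun g : gelt G => val g) (fun M : 'M[K]_N => M k l)).
  exact: initial_continuous.
exact: coord_continuous.
Qed.

Lemma continuous_mx (T : topologicalType) (f : T -> 'M[K]_N) :
  (forall k l, continuous (fun x => f x k l)) -> continuous f.
Proof.
move=> cf x A /nbhs_ballP[eps e0 epsA]; rewrite /nbhs /=.
have : \forall y \near x, forall k l, ball (f x k l) eps (f y k l).
  apply: filter_forall => k; apply: filter_forall => l.
  exact: (cf k l x _ (nbhsx_ballx _ _ e0)).
by apply: filterS => y xy; apply: epsA.
Qed.

Lemma gmul_continuous g : continuous (gmul g : gelt G -> gelt G).
Proof.
apply: (@continuous_comp_initial _ _ _ (set_val : gelt G -> 'M[K]_N)).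
apply: continuous_mx => k l.
have -> : (fun x : gelt G => (set_val \o gmul g) x k l) =
    (fun x : gelt G => \sum_(m < N) val g k m * val x m l).
  by apply/funext => x; rewrite /= mxE.
apply: continuous_big => [|m _ h]; first exact: (@add_continuous K^o).
by apply: cvgMl_tmp; [exact: nbhs_filter|exact: entry_continuous].
Qed.

Lemma gmul_measurable g : measurable_fun setT (gmul g : gborel G -> gborel G).
Proof.
apply: (@measurability _ _ _ (gborel G) _ _ (@open (gelt G))) => // _ [A oA <-].
rewrite setTI; apply: sub_sigma_algebra; by move/continuousP: (@gmul_continuous g); apply.
Qed.

Definition ginv g : gelt G :=
  exist _ (invmx (val g)) (mem_set (mg_inv (set_mem (valP g)))).

Lemma val_unit g : val g \in unitmx.
Proof. exact: (mg_unit (set_mem (valP g))). Qed.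

Lemma gmulK g : cancel (gmul g) (gmul (ginv g)).
Proof. by move=> h; apply: val_inj; rewrite /= mulKmx // val_unit. Qed.

Lemma gmulVK g : cancel (gmul (ginv g)) (gmul g).
Proof. by move=> h; apply: val_inj; rewrite /= mulKVmx // val_unit. Qed.

Variable mu : probability (gborel G) R.
Hypothesis haar : is_haar mu.

Lemma haar_preimage g (A : set (gborel G)) :
  measurable A -> mu (gmul g @^-1` A) = mu A.
Proof.
move=> mA; rewrite -(haar (ginv g) mA); congr (mu _).
apply/seteqP; split => h /=; last by move=> [h' Ah' <-]; rewrite gmulVK.
by move=> Ah; exists (gmul g h) => //; rewrite gmulK.
Qed.

Definition translate a g Q : gconfig G E := fun b => if b == a then gmul g (Q b) else Q b.

Lemma coord_measurable a : measurable_fun setT (fun Q => Q a : gborel G).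
Proof.
by move=> _ A mA; rewrite setTI; apply: sub_sigma_algebra; exists a, A.
Qed.

Lemma translate_measurable a g : measurable_fun setT (translate a g).
Proof.
apply: (@measurability _ _ _ (gconfig G E) _ _ (@cylinders _ _ G E)) => //.
move=> _ [_ [b [A [mA ->]]] <-]; rewrite setTI.
apply: sub_sigma_algebra; exists b; rewrite /translate.
case: (altP (b =P a)) => [->|ba].
  exists (gmul g @^-1` A); split; last by apply/seteqP; split => Q /=; rewrite eqxx.
  by rewrite -[X in measurable X]setTI; exact: gmul_measurable.
by exists A; split => //; apply/seteqP; split => Q /=; rewrite (negbTE ba).
Qed.

Variable nu : probability (gconfig G E) R.
Hypothesis prod : is_product mu nu.

Definition boxes : set (set (gconfig G E)) :=
  [set C | exists A : E -> set (gborel G),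
     (forall b, measurable (A b)) /\ C = [set Q | forall b, A b (Q b)]].

Lemma boxes_measurable : boxes `<=` measurable.
Proof.
move=> _ [A [mA ->]].
have -> : [set Q | forall b, A b (Q b)] = \bigcap_(b in [set: E]) [set Q : gconfig G E | A b (Q b)].
  by apply/seteqP; split => Q /= AQ b; [move=> _|]; exact: AQ.
apply: fin_bigcap_measurable; first exact: finite_finset.
by move=> b _; apply: sub_sigma_algebra; exists b, (A b).
Qed.

(** On boxes the invariance is that of the factor at [a]; boxes are stable under
    intersection and generate the sigma-algebra. *)
Lemma product_invariant a g (B : set (gconfig G E)) :
  measurable B -> nu (translate a g @^-1` B) = nu B.
Proof.
pose m1 : {measure set (gconfig G E) -> \bar R} :=
  measure_function_pushforward__canonical__measure_function_Measure nu (translate_measurable a g).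
rewrite -[LHS]/(m1 B).
apply: (measure_unique boxes (fun=> setT)).
- apply/seteqP; split; apply: smallest_sub; try exact: smallest_sigma_algebra.
    move=> _ [b [A [mA ->]]]; apply: sub_sigma_algebra.
    exists (fun c => if c == b then A else setT); split.
      by move=> c; case: eqP.
    apply/seteqP; split => Q /= => [AQ c|/(_ b)]; last by rewrite eqxx.
    by case: eqP => // ->.
  exact: boxes_measurable.
- move=> _ _ [A [mA ->]] [A' [mA' ->]]; exists (fun b => A b `&` A' b); split.
    by move=> b; exact: measurableI.
  apply/seteqP; split => Q /= => [[AQ AQ'] b|AQ]; first by split.
  by split => b; have [] := AQ b.
- move=> _; exists (fun=> setT); split => //.
  by apply/seteqP; split.
- by rewrite bigcup_const.
- move=> _ [A [mA ->]]; rewrite /m1 /= /pushforward.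
  pose A' b : set (gborel G) := if b == a then gmul g @^-1` (A b) else A b.
  have mA' b : measurable (A' b).
    rewrite /A'; case: eqP => // _.
    by rewrite -[X in measurable X]setTI; exact: gmul_measurable.
  transitivity (nu [set Q | forall b, A' b (Q b)]).
    congr (nu _); apply/seteqP; rewrite /A' /translate.
    by split => Q /= AQ b; have := AQ b; case: eqP.
  rewrite (prod mA) (prod mA'); apply: eq_bigr => b _.
  by rewrite /A'; case: eqP => // _; exact: haar_preimage.
- move=> _; rewrite /m1 /= /pushforward preimage_setT.
  by rewrite [X in (X < _)%E]probability_setT ltry.
Qed.

Lemma cintegral_translate a g (f : gconfig G E -> R[i]) : bounded_mfun f ->
  cintegral nu (f \o translate a g) = cintegral nu f.
Proof.
move=> bf; have [rf jf] := bmf_integrable nu bf; have [mr mi _] := bf.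
have mt := translate_measurable a g.
have trans (h : gconfig G E -> R) : measurable_fun setT h ->
    nu.-integrable setT (EFin \o (h \o translate a g)) ->
    Rintegral nu setT (h \o translate a g) = Rintegral nu setT h.
  move=> mh ih; congr fine.
  rewrite -[LHS](@integral_pushforward _ _ _ _ R _ mt nu setT (EFin \o h)) //.
    apply: eq_measure_integral => A mA _; exact: product_invariant.
  exact/measurable_EFinP.
have bft : bounded_mfun (f \o translate a g).
  by split; [exact: measurableT_comp mr mt|exact: measurableT_comp mi mt|];
    have [_ _ [M fM]] := bf; exists M => x; exact: fM.
have [rft jft] := bmf_integrable nu bft.
rewrite /cintegral; congr (_ +i* _).
  exact: (trans (Re \o f)).
exact: (trans (Im \o f)).
Qed.

End Translation.

(** * Quadratic bounds for the exponential *)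

Section CexpBound.
Variable R : realType.
Implicit Types (x y B rho : R) (z w : R[i]).

Lemma mvt_bound (f df : R -> R) x B :
  (forall y, is_derive y 1 f (df y)) -> f 0 = 0 ->
  (forall y, `|y| <= `|x| -> `|df y| <= B) -> `|f x| <= B * `|x|.
Proof.
move=> fdf f0 dfB.
have cf : continuous f by move=> y; apply/differentiable_continuous/derivable1_diffP; case: (fdf y).
have [x0|x0] := leP 0 x.
  have [c cx] := MVT_segment x0 (fun y _ => fdf y) (continuous_subspaceT cf).
  rewrite f0 !subr0 => ->; rewrite normrM ler_wpM2r // dfB //.
  by move: cx; rewrite in_itv /= => /andP[c0 cx]; rewrite !ger0_norm.
have [c cx] := MVT_segment (ltW x0) (fun y _ => fdf y) (continuous_subspaceT cf).
rewrite f0 !sub0r mulrN => /oppr_inj ->; rewrite normrM ler_wpM2r // dfB //.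
move: cx; rewrite in_itv /= => /andP[xc c0].
by rewrite !ler0_norm ?lerN2 // ltW.
Qed.

Lemma sin_bound x : `|sin x| <= `|x|.
Proof.
rewrite -[leRHS]mul1r; apply: (@mvt_bound _ cos); rewrite ?sin0 // => y _.
exact: cos_max.
Qed.

Lemma cosB1_bound x : `|cos x - 1| <= `|x|.
Proof.
rewrite -[leRHS]mul1r; apply: (@mvt_bound (fun x => cos x - 1) (fun y => - sin y)).
- by move=> y; apply: is_derive_eq; rewrite subr0.
- by rewrite cos0 subrr.
by move=> y _; rewrite normrN sin_max.
Qed.

Lemma cosB1_quad x : `|cos x - 1| <= x ^+ 2.
Proof.
rewrite -real_normK ?num_real // expr2.
apply: (@mvt_bound (fun x => cos x - 1) (fun y => - sin y)).
- by move=> y; apply: is_derive_eq; rewrite subr0.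
- by rewrite cos0 subrr.
by move=> y yx; rewrite normrN (le_trans (sin_bound y)).
Qed.

Lemma sinB_quad x : `|sin x - x| <= x ^+ 2.
Proof.
rewrite -real_normK ?num_real // expr2.
apply: (@mvt_bound (fun x => sin x - x) (fun y => cos y - 1)).
  by rewrite sin0 subrr.
by move=> y yx; rewrite (le_trans (cosB1_bound y)).
Qed.

Lemma expRB1_bound x B : `|x| <= B -> `|expR x - 1| <= expR B * `|x|.
Proof.
move=> xB; apply: (@mvt_bound (fun x => expR x - 1) expR).
- by move=> y; apply: is_derive_eq; rewrite subr0.
- by rewrite expR0 subrr.
move=> y yx; rewrite ger0_norm ?expR_ge0 // ler_expR.
by rewrite (le_trans (ler_norm y)) // (le_trans yx).
Qed.

Lemma expRB_quad x B : `|x| <= B -> `|expR x - 1 - x| <= expR B * x ^+ 2.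
Proof.
move=> xB; rewrite -real_normK ?num_real // expr2 mulrA.
apply: (@mvt_bound (fun x => expR x - 1 - x) (fun y => expR y - 1)).
- by move=> y; apply: is_derive_eq; rewrite subr0.
- by rewrite expR0 subrr subr0.
move=> y yx; apply: le_trans (expRB1_bound (le_trans yx xB)) _.
by rewrite ler_wpM2l // expR_ge0.
Qed.

Lemma cexpD z w : cexp (z + w) = cexp z * cexp w.
Proof.
case: z w => [a b] [a' b']; rewrite /cexp /= expRD cosD sinD.
by apply/eqP; rewrite eq_complex /=; apply/andP; split; apply/eqP; ring.
Qed.

Lemma cexp_real x : cexp x%:C = (expR x)%:C.
Proof. by rewrite /cexp /= cos0 sin0 mulr1. Qed.

(** Real part: exp x cos y - 1 - x = (exp x - 1 - x) + exp x (cos y - 1);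
    imaginary part: exp x sin y - y = (exp x - 1) sin y + (sin y - y). *)
Lemma cexp_quad w rho B : `|w| <= rho%:C -> rho <= B ->
  `|cexp w - 1 - w| <= (4 * expR B * rho ^+ 2)%:C.
Proof.
move=> wr rB.
have xr : `|Re w| <= rho by rewrite -lecR; exact: le_trans (normRe w) wr.
have yr : `|Im w| <= rho by rewrite -lecR; exact: le_trans (normIm w) wr.
have r0 : 0 <= rho by exact: le_trans (normr_ge0 _) xr.
have e1 : 1 <= expR B by rewrite -expR0 ler_expR (le_trans r0).
have x2 : Re w ^+ 2 <= rho ^+ 2 by rewrite -real_normK ?num_real // ler_pXn2r ?nnegrE.
have y2 : Im w ^+ 2 <= rho ^+ 2 by rewrite -real_normK ?num_real // ler_pXn2r ?nnegrE.
have ex := expRB_quad (le_trans xr rB).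
have ex1 := expRB1_bound (le_trans xr rB).
have cy := cosB1_quad (Im w); have sy := sinB_quad (Im w).
have s1 := sin_bound (Im w).
have exB : expR (Re w) <= expR B.
  by rewrite ler_expR (le_trans (ler_norm _)) // (le_trans xr).
rewrite (_ : 4 * _ * _ = 2 * (2 * expR B * rho ^+ 2)); last by ring.
rewrite /cexp; case: w xr yr x2 y2 ex ex1 cy sy s1 exB {wr} => x y /=.
move=> xr yr x2 y2 ex ex1 cy sy s1 exB.
apply: norm_le_parts => /=.
  rewrite (_ : _ - _ = (expR x - 1 - x) + expR x * (cos y - 1)); last by ring.
  apply: le_trans (ler_normD _ _) _; rewrite normrM (ger0_norm (expR_ge0 _)).
  rewrite (_ : 2 * _ * _ = expR B * rho ^+ 2 + expR B * rho ^+ 2); last by ring.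
  apply: lerD; first by rewrite (le_trans ex) // ler_wpM2l ?expR_ge0.
  by rewrite ler_pM ?expR_ge0 // (le_trans cy).
rewrite (_ : _ - _ = (expR x - 1) * sin y + (sin y - y)); last by ring.
apply: le_trans (ler_normD _ _) _; rewrite normrM.
apply: (@le_trans _ _ (expR B * rho * rho + rho ^+ 2)); last first.
  rewrite (_ : 2 * _ * _ = expR B * rho * rho + expR B * rho ^+ 2); last by ring.
  by rewrite lerD2l ler_peMl // sqr_ge0.
apply: lerD; last exact: le_trans sy y2.
apply: ler_pM => //; last exact: le_trans s1 yr.
by apply: (le_trans ex1); rewrite ler_wpM2l ?expR_ge0.
Qed.

End CexpBound.

(** * First-order expansions along a family of transformations *)

Section FirstOrder.
Context d (T : measurableType d) (R : realType) (tau : R -> T -> T).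
Implicit Types f g : T -> R[i].

(** Uniformity in the point is what allows integration term by term, with no
    convergence theorem. *)
Definition has_deriv f f' :=
  [/\ bounded_mfun f, bounded_mfun f' & exists2 M : R, 0 <= M &
      forall t x, 0 <= t <= 1 ->
        `|f (tau t x) - f x - t%:C * f' x| <= (M * t ^+ 2)%:C].

Lemma bmf_bound f : bounded_mfun f ->
  exists2 M : R, 0 <= M & forall x, `|f x| <= M%:C.
Proof.
move=> [_ _ [M fM]]; exists `|M| => // x; apply: le_trans (fM x) _.
by rewrite lecR ler_norm.
Qed.

Lemma has_deriv_lip f f' : has_deriv f f' -> exists2 M : R, 0 <= M &
  forall t x, 0 <= t <= 1 -> `|f (tau t x) - f x| <= (M * t)%:C.
Proof.
move=> [_ /bmf_bound[M' M'0 fM'] [M M0 fM]]; exists (M + M'); first exact: addr_ge0.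
move=> t x t01; rewrite -[_ - _](subrK (t%:C * f' x)).
apply: le_trans (ler_normD _ _) _; rewrite mulrDl rmorphD; apply: lerD.
  apply: le_trans (fM t x t01) _; rewrite lecR ler_wpM2l //.
  by case/andP: t01 => t0 t1; rewrite expr2 ler_piMr.
rewrite normrM mulrC rmorphM ler_pM // normC_real ger0_norm //.
by case/andP: t01.
Qed.

Lemma has_deriv_cst c : has_deriv (fun=> c) (fun=> 0).
Proof.
split; [exact: bmf_cst|exact: bmf_cst|exists 0 => // t x _].
by rewrite subrr mulr0 subr0 normr0 mul0r.
Qed.

Lemma has_derivD f f' g g' : has_deriv f f' -> has_deriv g g' ->
  has_deriv (fun x => f x + g x) (fun x => f' x + g' x).
Proof.
move=> [bf bf' [M M0 fM]] [bg bg' [M' M'0 gM']].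
split; [exact: bmfD|exact: bmfD|exists (M + M'); first exact: addr_ge0].
move=> t x t01; rewrite mulrDl rmorphD.
have -> : f (tau t x) + g (tau t x) - (f x + g x) - t%:C * (f' x + g' x) =
  (f (tau t x) - f x - t%:C * f' x) + (g (tau t x) - g x - t%:C * g' x) by ring.
by apply: le_trans (ler_normD _ _) _; apply: lerD; [exact: fM|exact: gM'].
Qed.

(** With f, g moved to F, G: F G - f g splits as
    (F - f) (G - g) + f (G - g) + g (F - f), whose first term is of order t^2. *)
Lemma has_derivM f f' g g' : has_deriv f f' -> has_deriv g g' ->
  has_deriv (fun x => f x * g x) (fun x => f' x * g x + f x * g' x).
Proof.
move=> hf hg; have [A A0 fA] := has_deriv_lip hf; have [B B0 gB] := has_deriv_lip hg.
case: hf hg => [bf bf' [M M0 fM]] [bg bg' [M' M'0 gM']].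
have [F F0 fF] := bmf_bound bf; have [H H0 gH] := bmf_bound bg.
split; [exact: bmfM|by apply: bmfD; exact: bmfM|].
exists (A * B + F * M' + H * M); first by rewrite !addr_ge0 ?mulr_ge0.
move=> t x t01.
have -> : f (tau t x) * g (tau t x) - f x * g x - t%:C * (f' x * g x + f x * g' x) =
  (f (tau t x) - f x) * (g (tau t x) - g x) +
  f x * (g (tau t x) - g x - t%:C * g' x) +
  g x * (f (tau t x) - f x - t%:C * f' x) by ring.
have -> : (A * B + F * M' + H * M) * t ^+ 2 =
  (A * t) * (B * t) + F * (M' * t ^+ 2) + H * (M * t ^+ 2) by ring.
rewrite !rmorphD !(rmorphM _ _ (B * t)) !(rmorphM _ F) !(rmorphM _ H) /=.
apply: le_trans (ler_normD _ _) _; apply: lerD; last first.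
  by rewrite normrM; apply: ler_pM => //; exact: fM.
apply: le_trans (ler_normD _ _) _; apply: lerD.
  by rewrite normrM; apply: ler_pM => //; [exact: fA|exact: gB].
by rewrite normrM; apply: ler_pM => //; exact: gM'.
Qed.

Lemma has_derivZ c f f' : has_deriv f f' ->
  has_deriv (fun x => c * f x) (fun x => c * f' x).
Proof.
move=> /(has_derivM (has_deriv_cst c)); congr has_deriv.
by apply/funext => x; rewrite mul0r add0r.
Qed.

Lemma has_deriv_sum (I : Type) (r : seq I) (F F' : I -> T -> R[i]) :
  (forall i, has_deriv (F i) (F' i)) ->
  has_deriv (fun x => \sum_(i <- r) F i x) (fun x => \sum_(i <- r) F' i x).
Proof.
move=> dF; elim: r => [|i r IH].
  have := has_deriv_cst 0; congr has_deriv; apply/funext => x; by rewrite big_nil.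
have := has_derivD (dF i) IH; congr has_deriv; apply/funext => x; by rewrite big_cons.
Qed.

Lemma has_deriv_prod (I : eqType) (r : seq I) (F F' : I -> T -> R[i]) : uniq r ->
  (forall i, has_deriv (F i) (F' i)) ->
  has_deriv (fun x => \prod_(i <- r) F i x)
            (fun x => \sum_(i <- r) F' i x * \prod_(k <- r | k != i) F k x).
Proof.
move=> + dF; elim: r => [_|i r IH /= /andP[ir ur]].
  have := has_deriv_cst 1; congr has_deriv; apply/funext => x; by rewrite big_nil.
have := has_derivM (dF i) (IH ur).
congr has_deriv; apply/funext => x; rewrite !big_cons // eqxx /=; congr (_ + _).
  congr (_ * _); rewrite [LHS]big_seq [RHS]big_seq_cond; apply: eq_bigl => k.
  by rewrite andbC; case: eqP => // ->; rewrite (negbTE ir).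
rewrite mulr_sumr; apply: eq_big_seq => k kr; rewrite big_cons.
by rewrite ifT 1?mulrCA //; apply: contraNneq ir => ->.
Qed.

Lemma bmf_cexp f : bounded_mfun f -> bounded_mfun (fun x => cexp (f x)).
Proof.
move=> [mr mi [M fM]]; have mexp := measurable_expR.
split.
- rewrite (_ : _ \o _ = (expR \o (Re \o f)) \* (cos \o (Im \o f))).
    apply: measurable_funM; first exact: measurableT_comp.
    apply: measurableT_comp mi; apply: continuous_measurable_fun.
    exact: continuous_cos.
  by apply/funext => x; rewrite /cexp /=; ring.
- rewrite (_ : _ \o _ = (expR \o (Re \o f)) \* (sin \o (Im \o f))).
    apply: measurable_funM; first exact: measurableT_comp.
    apply: measurableT_comp mi; apply: continuous_measurable_fun.
    exact: continuous_sin.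
  by apply/funext => x; rewrite /cexp /=; ring.
exists (2 * expR M) => x.
have eM : expR (Re (f x)) <= expR M.
  rewrite ler_expR; apply: le_trans (ler_norm _) _.
  by rewrite -lecR; exact: le_trans (normRe _) (fM x).
apply: norm_le_parts; rewrite /cexp /= !mul0r ?subr0 ?addr0.
  rewrite normrM ger0_norm ?expR_ge0 // -[leRHS]mulr1.
  by rewrite ler_pM ?expR_ge0 ?cos_max.
rewrite normrM ger0_norm ?expR_ge0 // -[leRHS]mulr1.
by rewrite ler_pM ?expR_ge0 ?sin_max.
Qed.

Lemma has_deriv_cexp f f' : has_deriv f f' ->
  has_deriv (fun x => cexp (f x)) (fun x => f' x * cexp (f x)).
Proof.
move=> hf; have [A A0 fA] := has_deriv_lip hf.
case: hf => [bf bf' [M M0 fM]]; have be := bmf_cexp bf.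
have [H H0 eH] := bmf_bound be.
split => //; first exact: bmfM.
exists (H * (4 * expR A * A ^+ 2 + M)).
  by rewrite mulr_ge0 ?addr_ge0 // !mulr_ge0 ?expR_ge0 ?sqr_ge0.
move=> t x t01; have [t0 t1] := andP t01.
set w := f (tau t x) - f x.
have -> : f (tau t x) = f x + w by rewrite addrC subrK.
rewrite cexpD.
have -> : cexp (f x) * cexp w - cexp (f x) - t%:C * (f' x * cexp (f x)) =
  cexp (f x) * ((cexp w - 1 - w) + (w - t%:C * f' x)) by ring.
rewrite normrM -mulrA rmorphM; apply: ler_pM => //.
rewrite mulrDl rmorphD; apply: le_trans (ler_normD _ _) _; apply: lerD; last exact: fM.
rewrite -mulrA -exprMn; apply: cexp_quad; first exact: fA.
by rewrite ler_piMr.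
Qed.

Variable nu : probability T R.
Hypothesis inv : forall t f, bounded_mfun f ->
  cintegral nu (f \o tau t) = cintegral nu f.
Hypothesis mtau : forall t, measurable_fun setT (tau t).

(** By invariance the integral of f (tau t x) - f x is zero, so t times the
    integral of f' is bounded by a multiple of t^2 for all small t. *)
Lemma integral_has_deriv f f' : has_deriv f f' -> cintegral nu f' = 0.
Proof.
move=> [bf bf' [M M0 fM]].
have bound t : 0 < t <= 1 -> `|cintegral nu f'| <= (2 * M * t)%:C.
  move=> /andP[t0 t1]; have t01 : 0 <= t <= 1 by rewrite ltW.
  have bft : bounded_mfun (f \o tau t).
    case: bf => mr mi [B fB]; split; [exact: measurableT_comp mr _|
      exact: measurableT_comp mi _|by exists B => x; exact: fB].
  have brem : bounded_mfun (fun x => f (tau t x) + (-1) * f x + (- t%:C) * f' x).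
    apply: bmfD; last exact: bmfZ.
    by apply: bmfD => //; exact: bmfZ.
  have := norm_cintegral nu (M := M * t ^+ 2) brem.
  have remE x : f (tau t x) + (-1) * f x + (- t%:C) * f' x =
      f (tau t x) - f x - t%:C * f' x by ring.
  rewrite cintegralD; last exact: bmfZ; last by apply: bmfD => //; exact: bmfZ.
  rewrite cintegralD //; last exact: bmfZ.
  rewrite !cintegralZ // (inv t bf) mulN1r subrr add0r normrM normrN normC_real.
  rewrite (gtr0_norm t0) => h.
  have {}h : t%:C * `|cintegral nu f'| <= t%:C * (2 * M * t)%:C.
    have -> : t%:C * (2 * M * t)%:C = (2 * (M * t ^+ 2))%:C.
      by rewrite -(rmorphM (real_complex R)) /=; congr (_%:C); ring.
    by apply: h => x; rewrite remE; exact: fM.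
  by rewrite ler_pM2l // ltcR in h.
have [r rE] : exists r, `|cintegral nu f'| = r%:C.
  by exists (Re `|cintegral nu f'|); rewrite RRe_real // normr_real.
apply/eqP; rewrite -normr_eq0 rE; suff -> : r = 0 by [].
have r0 : 0 <= r by rewrite -ler0c -rE.
apply/eqP; rewrite eq_le r0 andbT leNgt; apply/negP => rp.
pose t := r / (4 * M + r + 1).
have den : 0 < 4 * M + r + 1 by lra.
have t0 : 0 < t by rewrite divr_gt0.
have t1 : t <= 1 by rewrite ler_pdivrMr //; lra.
have := bound t; rewrite t0 t1 rE lecR => /(_ isT).
rewrite leNgt => /negP; apply; rewrite /t mulrA ltr_pdivrMr //; nra.
Qed.

End FirstOrder.

(** * Derivatives of holonomies *)

Section MatrixFunctions.
Context d (T : measurableType d) (R : realType) (N : nat).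
Implicit Types F H : T -> 'M[R[i]]_N.

Definition bounded_mxfun F := forall k l, bounded_mfun (fun x => F x k l).

Lemma bmx_cst (M : 'M[R[i]]_N) : bounded_mxfun (fun=> M).
Proof. by move=> k l; exact: bmf_cst. Qed.

Lemma bmxD F H : bounded_mxfun F -> bounded_mxfun H -> bounded_mxfun (fun x => F x + H x).
Proof.
by move=> bF bH k l; under eq_fun do rewrite mxE; exact: bmfD.
Qed.

Lemma bmxN F : bounded_mxfun F -> bounded_mxfun (fun x => - F x).
Proof. by move=> bF k l; under eq_fun do rewrite mxE; exact: bmfN. Qed.

Lemma bmxM F H : bounded_mxfun F -> bounded_mxfun H -> bounded_mxfun (fun x => F x *m H x).
Proof.
move=> bF bH k l; under eq_fun do rewrite mxE.
by apply: bmf_sum => m; exact: bmfM.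
Qed.

Lemma bmx_mull M F : bounded_mxfun F -> bounded_mxfun (fun x => M *m F x).
Proof. exact: (bmxM (bmx_cst M)). Qed.

Lemma bmx_mulr M F : bounded_mxfun F -> bounded_mxfun (fun x => F x *m M).
Proof. by move=> bF; exact: (bmxM bF (bmx_cst M)). Qed.

Lemma bmx_tr F : bounded_mxfun F -> bounded_mfun (fun x => \tr (F x)).
Proof. by move=> bF; apply: bmf_sum. Qed.

Variable tau : R -> T -> T.

Definition mx_has_deriv F F' :=
  forall k l, has_deriv tau (fun x => F x k l) (fun x => F' x k l).

Lemma mx_has_derivM F F' H H' : mx_has_deriv F F' -> mx_has_deriv H H' ->
  mx_has_deriv (fun x => F x *m H x) (fun x => F' x *m H x + F x *m H' x).
Proof.
move=> dF dH k l; have := has_deriv_sum (index_enum 'I_N) (fun m => has_derivM (dF k m) (dH m l)).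
by congr has_deriv; apply/funext => x; rewrite ?big_split !mxE.
Qed.

Lemma mx_has_deriv_cst M : mx_has_deriv (fun=> M) (fun=> 0).
Proof.
by move=> k l; have := has_deriv_cst tau (M k l); congr has_deriv; apply/funext => x; rewrite mxE.
Qed.

Lemma has_deriv_tr F F' : mx_has_deriv F F' ->
  has_deriv tau (fun x => \tr (F x)) (fun x => \tr (F' x)).
Proof. by move=> dF; apply: has_deriv_sum. Qed.

End MatrixFunctions.

Section Model.
Variables (K : numFieldType) (N : nat) (G : matrix_group K N) (L : finite_graph).
Variables (R : realType) (iota : {rmorphism K -> R[i]}).
(* The inclusion of the entries in R[i] lets one argument serve for complex and
   for real matrices; compactness of the group enters as a bound on entries, and
   its inverse as the conjugate transpose. *)
Hypothesis iotaRe : continuous (fun z : K => Re (iota z)).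
Hypothesis iotaIm : continuous (fun z : K => Im (iota z)).
Hypothesis iota_bound : forall (g : gelt G) k l, `|iota (val g k l)| <= 1.
Hypothesis iota_inv : forall (g : gelt G) k l,
  iota (invmx (val g) k l) = conjc (iota (val g l k)).

Local Notation T := (gconfig G (pedge L)).
Implicit Types (Q : T) (g : gelt G) (x e : oedge L).

Definition clink Q x : 'M[R[i]]_N := map_mx iota (link Q x).

Lemma clinkV Q x : clink Q x *m clink Q (oinv x) = 1%:M.
Proof.
rewrite /clink -map_mxM /link /=; case: x => a [] /=.
  by rewrite mulmxV ?map_mx1 // val_unit.
by rewrite mulVmx ?map_mx1 // val_unit.
Qed.

Lemma iota_bmf a k l : bounded_mfun (fun Q => iota (val (Q a) k l)).
Proof.
have ce : continuous (fun g => val g k l) := @entry_continuous K N G k l.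
split; last by exists 1 => Q; exact: iota_bound.
- apply: (@measurableT_comp _ _ _ _ _ _ (fun g : gborel G => Re (iota (val g k l)))).
    apply: continuous_borel => g.
    apply: (@continuous_comp _ _ _ (fun g : gelt G => val g k l) (fun z : K => Re (iota z))).
      exact: ce.
    exact: iotaRe.
  exact: coord_measurable.
- apply: (@measurableT_comp _ _ _ _ _ _ (fun g : gborel G => Im (iota (val g k l)))).
    apply: continuous_borel => g.
    apply: (@continuous_comp _ _ _ (fun g : gelt G => val g k l) (fun z : K => Im (iota z))).
      exact: ce.
    exact: iotaIm.
  exact: coord_measurable.
Qed.

Lemma bmf_conj (f : T -> R[i]) : bounded_mfun f -> bounded_mfun (fun Q => conjc (f Q)).
Proof.
move=> [mr mi [M fM]]; split; last by exists M => x; rewrite normcJ.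
- by move: mr; congr measurable_fun; apply/funext => x /=; case: (f x).
- rewrite (_ : _ \o _ = \- (Im \o f)); first exact: measurable_funN.
  by apply/funext => x /=; case: (f x).
Qed.

Lemma clink_bmx x : bounded_mxfun (fun Q => clink Q x).
Proof.
move=> k l; case: x => a [].
  apply: eq_bmf (iota_bmf a k l) => Q; by rewrite /clink mxE.
apply: eq_bmf (bmf_conj (iota_bmf a l k)) => Q.
by rewrite /clink mxE -iota_inv.
Qed.

Lemma hol_bmx l : bounded_mxfun (fun Q => hol (clink Q) l).
Proof.
elim: l => [|x l IH] k m.
  by apply: eq_bmf (@bmx_cst _ T R N 1%:M k m) => Q; rewrite hol_nil.
by apply: eq_bmf (bmxM (clink_bmx x) IH k m) => Q; rewrite hol_cons.
Qed.

Lemma trh_bmf l : bounded_mfun (fun Q => trh (clink Q) l).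
Proof. by apply: bmx_tr; exact: hol_bmx. Qed.

Lemma dlink_bmx e X x :
  bounded_mxfun (fun Q => if x == e then X *m clink Q x
              else if x == oinv e then - (clink Q x *m X) else 0).
Proof.
case: (x == e); first by apply: bmx_mull; exact: clink_bmx.
case: (x == oinv e); last exact: bmx_cst.
by apply: bmxN; apply: bmx_mulr; exact: clink_bmx.
Qed.

Lemma dhol_bmx e X l : bounded_mxfun (fun Q => dhol (clink Q) e X l).
Proof.
elim: l => [|x l IH] /=; first exact: bmx_cst.
have h1 := bmxM (dlink_bmx e X x) (hol_bmx l).
have h2 := bmxM (clink_bmx x) IH.
exact: bmxD h1 h2.
Qed.

Section Path.
Variables (a : pedge L) (gt : R -> gelt G) (X : 'M[R[i]]_N).

(** Only first order at the identity matters; the paths used below are defined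
    for all times. *)
Definition tangent (h : R -> gelt G) (Y : 'M[R[i]]_N) :=
  exists2 M : R, 0 <= M & forall t k l, 0 <= t <= 1 ->
    `|(map_mx iota (val (h t)) - 1%:M - t%:C *: Y) k l| <= (M * t ^+ 2)%:C.

Hypothesis gtX : tangent gt X.
Hypothesis gtV : tangent (fun t => ginv (gt t)) (- X).

Local Notation tau := (fun t Q => translate a (gt t) Q).

Lemma entry_bound (F : T -> 'M[R[i]]_N) : bounded_mxfun F ->
  exists2 M : R, 0 <= M & forall Q k l, `|F Q k l| <= M%:C.
Proof.
move=> bF; have h k l := bmf_bound (bF k l).
pose m k l := projT1 (cid2 (h k l)).
have m0 k l : 0 <= m k l by rewrite /m; case: cid2.
have mP k l Q : `|F Q k l| <= (m k l)%:C by rewrite /m; case: cid2.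
exists (\sum_k \sum_l m k l).
  by apply: sumr_ge0 => k _; apply: sumr_ge0.
move=> Q k l; apply: le_trans (mP k l Q) _; rewrite lecR.
rewrite (bigD1 k) //= (bigD1 l) //= -addrA lerDl addr_ge0 //.
  exact: sumr_ge0.
by apply: sumr_ge0 => k' _; apply: sumr_ge0.
Qed.

Lemma mulmx_entry_bound (A B : 'M[R[i]]_N) (M M' : R) : 0 <= M -> 0 <= M' ->
  (forall k l, `|A k l| <= M%:C) -> (forall k l, `|B k l| <= M'%:C) ->
  forall k l, `|(A *m B) k l| <= (N%:R * (M * M'))%:C.
Proof.
move=> M0 M'0 AM BM k l; rewrite mxE; apply: le_trans (ler_norm_sum _ _ _) _.
apply: (@le_trans _ _ (\sum_(m < N) (M * M')%:C)).
  by apply: ler_sum => m _; rewrite normrM rmorphM ler_pM.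
by rewrite sumr_const card_ord mulr_natl rmorphMn.
Qed.

Lemma link_translate t Q x :
  clink (translate a (gt t) Q) x =
  if x.1 == a then (if x.2 then map_mx iota (val (gt t)) *m clink Q x
                    else clink Q x *m map_mx iota (val (ginv (gt t))))
  else clink Q x.
Proof.
rewrite /clink /link /translate; case: eqP => // xa; case: x.2.
  by rewrite map_mxM.
rewrite -map_mxM; congr map_mx => /=.
set A := val _; set B := val _.
have u : A *m B \in unitmx by rewrite unitmx_mul !val_unit.
rewrite -[RHS](mulKmx u) [X in _ = _ *m X]mulmxA -(mulmxA A) mulmxV ?val_unit //.
by rewrite mulmx1 mulmxV ?val_unit // mulmx1.
Qed.

(** For g = 1 + t X + O(t^2) the chosen orientation becomes g Q and the other
    Q^-1 g^-1, so both g and its inverse must be expanded. *)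
Lemma clink_has_deriv x :
  mx_has_deriv tau (fun Q => clink Q x)
    (fun Q => if x == (a, true) then X *m clink Q x
              else if x == oinv (a, true) then - (clink Q x *m X) else 0).
Proof.
have [B B0 clB] := entry_bound (clink_bmx x).
have [[M M0 gM] [M' M'0 gM']] := (gtX, gtV).
move=> k l; split; [exact: clink_bmx|exact: dlink_bmx|].
have C0 : 0 <= N%:R * (M * B) + N%:R * (B * M') by rewrite addr_ge0 ?mulr_ge0.
exists (N%:R * (M * B) + N%:R * (B * M')) => //.
move=> t Q t01; rewrite link_translate.
have sq0 : 0 <= t ^+ 2 by exact: sqr_ge0.
have Mt : 0 <= M * t ^+ 2 by exact: mulr_ge0.
have Mt' : 0 <= M' * t ^+ 2 by exact: mulr_ge0.
case: x clB => b [] clB /=; rewrite /oinv /= !xpair_eqE /= ?andbT ?andbF.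
  case: eqP => /= [_|_]; last first.
    by rewrite [X in _ * X]mxE mulr0 subr0 subrr normr0 ler0c mulr_ge0.
  have -> : (map_mx iota (val (gt t)) *m clink Q (b, true)) k l - clink Q (b, true) k l -
     t%:C * (X *m clink Q (b, true)) k l =
     ((map_mx iota (val (gt t)) - 1%:M - t%:C *: X) *m clink Q (b, true)) k l.
    by rewrite !mulmxBl mul1mx -scalemxAl !mxE.
  apply: le_trans (mulmx_entry_bound (M := M * t ^+ 2) (M' := B) _ _ _ _ k l) _ => //.
    by move=> k' l'; exact: gM.
  rewrite lecR -subr_ge0 (_ : _ - _ = N%:R * (B * M') * t ^+ 2); last by ring.
  by apply: mulr_ge0 => //; apply: mulr_ge0 => //; exact: mulr_ge0.
case: eqP => /= [_|_]; last first.
  by rewrite [X in _ * X]mxE mulr0 subr0 subrr normr0 ler0c mulr_ge0.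
have -> : (clink Q (b, false) *m map_mx iota (val (ginv (gt t)))) k l - clink Q (b, false) k l -
   t%:C * (- (clink Q (b, false) *m X)) k l =
   (clink Q (b, false) *m (map_mx iota (val (ginv (gt t))) - 1%:M - t%:C *: (- X))) k l.
  by rewrite !mulmxBr mulmx1 -scalemxAr mulmxN !mxE.
apply: le_trans (mulmx_entry_bound (M := B) (M' := M' * t ^+ 2) _ _ _ _ k l) _ => //.
  by move=> k' l'; exact: gM'.
rewrite lecR -subr_ge0 (_ : _ - _ = N%:R * (M * B) * t ^+ 2); last by ring.
by apply: mulr_ge0 => //; apply: mulr_ge0 => //; exact: mulr_ge0.
Qed.

Lemma hol_has_deriv l :
  mx_has_deriv tau (fun Q => hol (clink Q) l) (fun Q => dhol (clink Q) (a, true) X l).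
Proof.
elim: l => [|x l IH] /=.
  have -> : (fun Q => hol (clink Q) [::]) = fun=> 1%:M.
    by apply/funext => Q; rewrite hol_nil.
  exact: mx_has_deriv_cst.
have -> : (fun Q => hol (clink Q) (x :: l)) = fun Q => clink Q x *m hol (clink Q) l.
  by apply/funext => Q; rewrite hol_cons.
exact: (mx_has_derivM (clink_has_deriv x) IH).
Qed.

End Path.

(** * Integration by parts *)

Section TestFunctions.
Variables (P : seq (seq (oedge L))) (s : string L) (i : nat) (e : oedge L).
Variables (A B : seq (oedge L)) (beta : R).
Local Notation a := e.1.
Local Notation n := (N%:R : R[i]).

Definition weight Q : R[i] :=
  \prod_(p <- P) cexp (n * beta%:C * trh (clink Q) p).

Lemma weightE Q : weight Q = cexp (\sum_(p <- P) n * beta%:C * trh (clink Q) p).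
Proof.
rewrite /weight; elim: P => [|p P' IH]; last by rewrite !big_cons IH cexpD.
by rewrite !big_nil -[0]/((0 : R)%:C) cexp_real expR0.
Qed.

Lemma weight_bmf : bounded_mfun weight.
Proof.
apply: (@eq_bmf _ _ _ (fun Q => cexp (\sum_(p <- P) n * beta%:C * trh (clink Q) p))).
  by move=> Q; rewrite weightE.
apply: bmf_cexp; apply: bmf_sum => p; apply: bmfZ; exact: trh_bmf.
Qed.

Definition integrand X Y Q : R[i] :=
  grad (clink Q) P s i e A B beta%:C X Y * weight Q.

Lemma mul_based_bmf Y : bounded_mfun (fun Q => \tr (Y *m hol (clink Q) (based e (B ++ A)))).
Proof. by apply: bmx_tr; apply: bmx_mull; exact: hol_bmx. Qed.

Lemma lderiv_bmf X l : bounded_mfun (fun Q => \tr (lderiv (clink Q) e X l)).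
Proof. apply: bmx_tr; exact: dhol_bmx. Qed.

Lemma wilson_factor_bmf r : bounded_mfun (fun Q => n^-1 * trh (clink Q) (loop_at s r)).
Proof. by apply: bmfZ; exact: trh_bmf. Qed.

Lemma integrand_bmf X Y : bounded_mfun (integrand X Y).
Proof.
have br : bounded_mfun (fun Q => rest (clink Q) s i).
  by apply: bmf_prod => r; exact: wilson_factor_bmf.
have b1 : bounded_mfun (fun Q => \tr (Y *m lderiv (clink Q) e X (based e (B ++ A)))).
  by apply: bmx_tr; apply: bmx_mull; exact: dhol_bmx.
have b2 : bounded_mfun (fun Q => \sum_(r <- others s i)
    n^-1 * \tr (lderiv (clink Q) e X (loop_at s r)) * rest2 (clink Q) s i r).
  apply: bmf_sum => r; apply: bmfM; first by apply: bmfZ; exact: lderiv_bmf.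
  by apply: bmf_prod => k; exact: wilson_factor_bmf.
have b3 : bounded_mfun (fun Q => n * beta%:C * \sum_(p <- P) \tr (lderiv (clink Q) e X p)).
  by apply: bmfZ; apply: bmf_sum => p; exact: lderiv_bmf.
apply: bmfM; last exact: weight_bmf.
have h := bmfD (bmfD (bmfM b1 br) (bmfM (mul_based_bmf Y) b2))
  (bmfM (bmfM (mul_based_bmf Y) br) b3).
exact: h.
Qed.

Section AlongPath.
Variables (gt : R -> gelt G) (X : 'M[R[i]]_N).
Hypothesis gtX : tangent gt X.
Hypothesis gtV : tangent (fun t => ginv (gt t)) (- X).
Local Notation tau := (fun t Q => translate a (gt t) Q).

Lemma integrand_has_deriv Y :
  has_deriv tau
    (fun Q => \tr (Y *m hol (clink Q) (based e (B ++ A))) * rest (clink Q) s i * weight Q)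
    (integrand X Y).
Proof.
have dt l : has_deriv tau (fun Q => trh (clink Q) l) (fun Q => \tr (lderiv (clink Q) e X l)).
  exact: has_deriv_tr (hol_has_deriv a gtX gtV l).
have d1 : has_deriv tau (fun Q => \tr (Y *m hol (clink Q) (based e (B ++ A))))
    (fun Q => \tr (Y *m lderiv (clink Q) e X (based e (B ++ A)))).
  have := has_deriv_tr (mx_has_derivM (mx_has_deriv_cst tau Y)
    (hol_has_deriv a gtX gtV (based e (B ++ A)))).
  by congr has_deriv; apply/funext => Q; rewrite mul0mx add0r.
have d2 := has_deriv_prod (filter_uniq (fun r => r != i) (iota_uniq 0 (size s)))
  (fun r => has_derivZ n^-1 (dt (loop_at s r))).
have d3 := has_deriv_cexp (has_deriv_sum P (fun p => has_derivZ (n * beta%:C) (dt p))).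
have := has_derivM (has_derivM d1 d2) d3.
congr has_deriv; apply/funext => Q; first by rewrite weightE.
by rewrite /integrand /grad weightE -!mulr_sumr -/(others s i) /rest /rest2; ring.
Qed.

End AlongPath.

Lemma integrand_linearX Y Q : linear (fun X => (integrand X Y Q : R[i]^o)).
Proof.
move=> c X X'; have lin l : lderiv (clink Q) e (c *: X + X') l =
    c *: lderiv (clink Q) e X l + lderiv (clink Q) e X' l by exact: dhol_is_linear.
rewrite /integrand /grad lin mulmxDr -scalemxAr mxtraceD mxtraceZ.
under eq_bigr do rewrite lin mxtraceD mxtraceZ mulrDr mulrDl mulrCA -!(mulrA c).
under [\sum_(p <- P) _]eq_bigr do rewrite lin mxtraceD mxtraceZ.
by rewrite !big_split /= -!mulr_sumr /GRing.scale /=; ring.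
Qed.

Lemma integrand_linearY X Q : linear (fun Y => (integrand X Y Q : R[i]^o)).
Proof.
move=> c Y Y'; rewrite /integrand /grad !mulmxDl -!scalemxAl !mxtraceD !mxtraceZ.
by rewrite /GRing.scale /=; ring.
Qed.

Variables (mu : probability (gborel G) R) (nu : probability T R).
Hypotheses (haar : is_haar mu) (prod : is_product mu nu).

(** Integral of D_X F_Y. It is bilinear, so it vanishes for all X in the complex
    span of the velocities of paths in the group. *)
Definition pairing X Y : R[i] := cintegral nu (integrand X Y).

Lemma pairing_path gt X Y : tangent gt X -> tangent (fun t => ginv (gt t)) (- X) ->
  pairing X Y = 0.
Proof.
move=> gtX gtV; apply: (integral_has_deriv _ _ (integrand_has_deriv gtX gtV Y)).
  by move=> t f bf; exact: (cintegral_translate haar prod).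
by move=> t; exact: translate_measurable.
Qed.

Lemma pairing_linearX Y : linear (fun X => (pairing X Y : R[i]^o)).
Proof.
move=> c X X'; rewrite /pairing /GRing.scale /=.
rewrite -cintegralZ; last exact: integrand_bmf.
rewrite -cintegralD; [|by apply: bmfZ; exact: integrand_bmf|exact: integrand_bmf].
by congr (cintegral _ _); apply/funext => Q; exact: integrand_linearX.
Qed.

Lemma pairing_linearY X : linear (fun Y => (pairing X Y : R[i]^o)).
Proof.
move=> c Y Y'; rewrite /pairing /GRing.scale /=.
rewrite -cintegralZ; last exact: integrand_bmf.
rewrite -cintegralD; [|by apply: bmfZ; exact: integrand_bmf|exact: integrand_bmf].
by congr (cintegral _ _); apply/funext => Q; exact: integrand_linearY.
Qed.

(** Expectation of a string without the partition function in the denominator. *)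
Definition wexp (s' : string L) : R[i] :=
  cintegral nu (fun Q => wil (clink Q) s' * weight Q).

Lemma wil_bmf s' : bounded_mfun (fun Q => wil (clink Q) s').
Proof. by apply: bmf_prod => l; apply: bmfZ; exact: trh_bmf. Qed.

(** The pointwise identities are linear combinations of sums over families of
    strings; [c] lists the coefficients with the families. *)
Lemma wexp_comb (c : seq (R[i] * seq (string L))) :
  cintegral nu (fun Q =>
    (\sum_(t <- c) t.1 * \sum_(s' <- t.2) wil (clink Q) s') * weight Q) =
  \sum_(t <- c) t.1 * \sum_(s' <- t.2) wexp s'.
Proof.
have bw s' : bounded_mfun (fun Q => wil (clink Q) s' * weight Q).
  by apply: bmfM; [exact: wil_bmf|exact: weight_bmf].
transitivity (cintegral nu (fun Q =>
    \sum_(t <- c) t.1 * \sum_(s' <- t.2) (wil (clink Q) s' * weight Q))).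
  congr (cintegral _ _); apply/funext => Q; rewrite mulr_suml.
  by apply: eq_bigr => t _; rewrite -mulrA mulr_suml.
rewrite cintegral_sum; last first.
  by move=> t; apply: bmfZ; apply: bmf_sum => s'; exact: bw.
apply: eq_bigr => t _; rewrite cintegralZ; last by apply: bmf_sum => s'; exact: bw.
by congr (_ * _); exact: cintegral_sum.
Qed.

Local Notation E := (@delta_mx R[i] N N).

Lemma cintegral_affine (c1 c2 c3 u v : R[i]) (f g : T -> R[i]) :
  bounded_mfun f -> bounded_mfun g -> cintegral nu f = u -> cintegral nu g = v ->
  cintegral nu (fun Q => c1 * (c2 * (f Q + c3 * g Q))) = c1 * (c2 * (u + c3 * v)).
Proof.
move=> bf bg <- <-; have bg3 := bmfZ c3 bg.
rewrite cintegralZ; last by apply: bmfZ; exact: bmfD.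
by rewrite cintegralZ ?cintegralD ?cintegralZ //; exact: bmfD.
Qed.

Lemma cintegral_pairing (I : Type) (r : seq I) (X Y : I -> I -> 'M[R[i]]_N) :
  cintegral nu (fun Q => \sum_(a <- r) \sum_(b <- r) integrand (X a b) (Y a b) Q) =
  \sum_(a <- r) \sum_(b <- r) pairing (X a b) (Y a b).
Proof.
rewrite cintegral_sum; last by move=> a; apply: bmf_sum => b; exact: integrand_bmf.
by apply: eq_bigr => a _; apply: cintegral_sum => b; exact: integrand_bmf.
Qed.

Lemma pairing0Y X : pairing X 0 = 0.
Proof.
by have := pairing_linearY X (-1) 0 0; rewrite scaler0 addr0 /GRing.scale /= mulN1r addNr.
Qed.

Lemma pairing0X Y : pairing 0 Y = 0.
Proof.
by have := pairing_linearX Y (-1) 0 0; rewrite scaler0 addr0 /GRing.scale /= mulN1r addNr.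
Qed.

Lemma pairing_sumY X (I : Type) (r : seq I) (F : I -> 'M[R[i]]_N) :
  pairing X (\sum_(k <- r) F k) = \sum_(k <- r) pairing X (F k).
Proof.
elim: r => [|k r IH]; first by rewrite !big_nil pairing0Y.
by rewrite !big_cons -IH; have := pairing_linearY X 1 (F k) (\sum_(j <- r) F j); rewrite !scale1r.
Qed.

Lemma pairing_sumX Y (I : Type) (r : seq I) (F : I -> 'M[R[i]]_N) :
  pairing (\sum_(k <- r) F k) Y = \sum_(k <- r) pairing (F k) Y.
Proof.
elim: r => [|k r IH]; first by rewrite !big_nil pairing0X.
by rewrite !big_cons -IH; have := pairing_linearX Y 1 (F k) (\sum_(j <- r) F j); rewrite !scale1r.
Qed.

Hypothesis N_gt0 : (0 < N)%N.
Hypothesis si : loop_at s i = A ++ e :: B.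

Let n0 : n != 0. Proof. by rewrite pnatr_eq0 -lt0n. Qed.

Lemma sum_delta_mx : \sum_(a < N) E a a = 1%:M.
Proof.
apply/matrixP => k l; rewrite summxE (bigD1 k) //= big1 => [|a ak]; last first.
  by rewrite mxE eq_sym (negbTE ak).
by rewrite !mxE eqxx addr0 eq_sym.
Qed.

(** The hypotheses say that the trace-free directions integrate to zero; summing
    the diagonal ones over b gives N E_aa - 1, which accounts for the scalar
    correction. *)
Lemma loop_equation_sl :
  (forall a b Y, a != b -> pairing (E a b) Y = 0) ->
  (forall a b Y, pairing (E a a) Y = pairing (E b b) Y) ->
  (1 - (tcount e s)%:~R / n ^+ 2) * wexp s +
  \sum_(s' <- split_pos e i (size A) s) wexp s' -
  \sum_(s' <- split_neg e i (size A) s) wexp s' +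
  (n ^+ 2)^-1 * (\sum_(s' <- mergeU_pos e i (size A) s) wexp s') -
  (n ^+ 2)^-1 * (\sum_(s' <- mergeU_neg e i (size A) s) wexp s') +
  beta%:C * (\sum_(s' <- deform_pos P e i (size A) s) wexp s') -
  beta%:C * (\sum_(s' <- deform_neg P e i (size A) s) wexp s') +
  beta%:C * (\sum_(s' <- expand_pos P e s) wexp s') -
  beta%:C * (\sum_(s' <- expand_neg P e s) wexp s') = 0.
Proof.
move=> off diag.
pose c : seq (R[i] * seq (string L)) := [::
  (1 - (tcount e s)%:~R / n ^+ 2, [:: s]);
  (1, split_pos e i (size A) s); (-1, split_neg e i (size A) s);
  ((n ^+ 2)^-1, mergeU_pos e i (size A) s); (- (n ^+ 2)^-1, mergeU_neg e i (size A) s);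
  (beta%:C, deform_pos P e i (size A) s); (- beta%:C, deform_neg P e i (size A) s);
  (beta%:C, expand_pos P e s); (- beta%:C, expand_neg P e s)].
transitivity (\sum_(t <- c) t.1 * \sum_(s' <- t.2) wexp s').
  by rewrite /c !big_cons !big_nil /=; ring.
rewrite -wexp_comb.
transitivity (cintegral nu (fun Q => (n ^+ 2)^-1 * (osgn R[i] e *
    (\sum_a \sum_b integrand (E a b) (E b a) Q + - n^-1 * integrand 1%:M 1%:M Q)))).
  congr (cintegral _ _); apply/funext => Q.
  transitivity ((n ^+ 2)^-1 * (osgn R[i] e *
    (\sum_a \sum_b grad (clink Q) P s i e A B beta%:C (E a b) (E b a) -
     n^-1 * grad (clink Q) P s i e A B beta%:C 1%:M 1%:M)) * weight Q).
    congr (_ * _); rewrite (loop_identity_sl (clinkV Q) n0 P _ si) /c !big_cons !big_nil /=.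
    by ring.
  have -> : \sum_a \sum_b integrand (E a b) (E b a) Q =
      (\sum_a \sum_b grad (clink Q) P s i e A B beta%:C (E a b) (E b a)) * weight Q.
    by rewrite mulr_suml; apply: eq_bigr => k _; rewrite mulr_suml.
  by rewrite /integrand; ring.
have bg : bounded_mfun (fun Q => \sum_a \sum_b integrand (E a b) (E b a) Q).
  by apply: bmf_sum => k; apply: bmf_sum => l; exact: integrand_bmf.
etransitivity; first exact: (cintegral_affine _ _ _ bg (integrand_bmf 1%:M 1%:M)
  (cintegral_pairing _ _ _) (erefl (pairing 1%:M 1%:M))).
have -> : pairing 1%:M 1%:M = n * \sum_k pairing (E k k) (E k k).
  have -> : pairing 1%:M 1%:M = pairing (\sum_(k < N) E k k) (\sum_(k < N) E k k).
    by rewrite sum_delta_mx.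
  transitivity (\sum_(k < N) \sum_(l < N) pairing (E k k) (E l l)).
    etransitivity; first exact: pairing_sumX.
    by apply: eq_bigr => k _; exact: pairing_sumY.
  rewrite exchange_big mulr_sumr; apply: eq_bigr => k _ /=.
  under eq_bigr do rewrite (diag _ k).
  by rewrite sumr_const card_ord mulr_natl.
have -> : \sum_a \sum_b pairing (E a b) (E b a) = \sum_k pairing (E k k) (E k k).
  apply: eq_bigr => k _; rewrite (bigD1 k) //= big1 ?addr0 // => l lk.
  by rewrite off // eq_sym.
by rewrite mulNr mulKf // subrr !mulr0.
Qed.

Lemma loop_equation_so :
  (forall Q x, clink Q (oinv x) = (clink Q x)^T) -> plaquette_set P ->
  (forall a b Y, pairing (E a b) Y = pairing (E b a) Y) ->
  (1 - n^-1) * wexp s +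
  \sum_(s' <- split_pos e i (size A) s) wexp s' -
  \sum_(s' <- split_neg e i (size A) s) wexp s' +
  (n ^+ 2)^-1 * (\sum_(s' <- merge_pos e i (size A) s) wexp s') -
  (n ^+ 2)^-1 * (\sum_(s' <- merge_neg e i (size A) s) wexp s') +
  n^-1 * (\sum_(s' <- twist_pos e i (size A) s) wexp s') -
  n^-1 * (\sum_(s' <- twist_neg e i (size A) s) wexp s') +
  2 * beta%:C * (\sum_(s' <- deform_pos P e i (size A) s) wexp s') -
  2 * beta%:C * (\sum_(s' <- deform_neg P e i (size A) s) wexp s') = 0.
Proof.
move=> linkT plaqP sym.
pose c : seq (R[i] * seq (string L)) := [::
  (1 - n^-1, [:: s]);
  (1, split_pos e i (size A) s); (-1, split_neg e i (size A) s);
  ((n ^+ 2)^-1, merge_pos e i (size A) s); (- (n ^+ 2)^-1, merge_neg e i (size A) s);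
  (n^-1, twist_pos e i (size A) s); (- n^-1, twist_neg e i (size A) s);
  (2 * beta%:C, deform_pos P e i (size A) s); (- (2 * beta%:C), deform_neg P e i (size A) s)].
transitivity (\sum_(t <- c) t.1 * \sum_(s' <- t.2) wexp s').
  by rewrite /c !big_cons !big_nil /=; ring.
rewrite -wexp_comb.
transitivity (cintegral nu (fun Q => (n ^+ 2)^-1 * (osgn R[i] e *
    (\sum_a \sum_b integrand (E a b) (E b a) Q +
     -1 * \sum_a \sum_b integrand (E b a) (E b a) Q)))).
  congr (cintegral _ _); apply/funext => Q.
  transitivity ((n ^+ 2)^-1 * (osgn R[i] e *
    (\sum_a \sum_b grad (clink Q) P s i e A B beta%:C (E a b) (E b a) -
     \sum_a \sum_b grad (clink Q) P s i e A B beta%:C (E b a) (E b a))) * weight Q).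
    congr (_ * _); rewrite (loop_identity_so (clinkV Q) n0 _ si (linkT Q) plaqP).
    by rewrite /c !big_cons !big_nil /=; ring.
  have -> : \sum_a \sum_b integrand (E a b) (E b a) Q =
      (\sum_a \sum_b grad (clink Q) P s i e A B beta%:C (E a b) (E b a)) * weight Q.
    by rewrite mulr_suml; apply: eq_bigr => k _; rewrite mulr_suml.
  have -> : \sum_a \sum_b integrand (E b a) (E b a) Q =
      (\sum_a \sum_b grad (clink Q) P s i e A B beta%:C (E b a) (E b a)) * weight Q.
    by rewrite mulr_suml; apply: eq_bigr => k _; rewrite mulr_suml.
  by ring.
have bg : bounded_mfun (fun Q => \sum_a \sum_b integrand (E a b) (E b a) Q).
  by apply: bmf_sum => k; apply: bmf_sum => l; exact: integrand_bmf.
have bg' : bounded_mfun (fun Q => \sum_a \sum_b integrand (E b a) (E b a) Q).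
  by apply: bmf_sum => k; apply: bmf_sum => l; exact: integrand_bmf.
etransitivity; first exact: (cintegral_affine _ _ _ bg bg'
  (cintegral_pairing _ _ _) (cintegral_pairing _ _ _)).
have cancel (u v : R[i]) : u = v -> (n ^+ 2)^-1 * (osgn R[i] e * (u + -1 * v)) = 0.
  by move=> ->; rewrite mulN1r subrr !mulr0.
by apply: cancel; apply: eq_bigr => k _; apply: eq_bigr => l _; exact: sym.
Qed.

End TestFunctions.
End Model.

(** * Rotations *)

Section Rotation.
Variables (K : fieldType) (N : nat) (X : 'M[K]_N).
Hypothesis X3 : X *m X *m X = - X.

(** The exponential of an angle times X when X^3 = -X, with [s] and [c] the sine
    and the cosine of the angle. *)
Definition rotmx (s c : K) : 'M[K]_N := 1%:M + s *: X + (1 - c) *: (X *m X).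

Lemma rotmxD s c s' c' :
  rotmx s c *m rotmx s' c' = rotmx (s * c' + c * s') (c * c' - s * s').
Proof.
have X4 : X *m X *m (X *m X) = - (X *m X) by rewrite mulmxA X3 mulNmx.
have X3' : X *m (X *m X) = - X by rewrite mulmxA.
rewrite /rotmx !mulmxDl !mulmxDr !mul1mx !mulmx1 -!scalemxAl -!scalemxAr.
rewrite X3 X4 X3' !scalerA; move: (X *m X) => X2.
by apply/matrixP => k l; rewrite !mxE; ring.
Qed.

Lemma rotmx0 : rotmx 0 1 = 1%:M.
Proof. by rewrite /rotmx subrr !scale0r !addr0. Qed.

Variable S : 'M[K]_N.
Hypothesis S2 : S *m S = 1%:M.
Hypothesis SX : S *m X = - (X *m S).

Lemma det_rotmxN s c : \det (rotmx (- s) c) = \det (rotmx s c).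
Proof.
have dS : \det S * \det S = 1 by rewrite -det_mulmx S2 det1.
have conj : rotmx (- s) c *m S = S *m rotmx s c.
  rewrite /rotmx !mulmxDl !mulmxDr mul1mx mulmx1 -!scalemxAl -!scalemxAr SX.
  rewrite scaleNr scalerN; congr (_ + _ *: _).
  by rewrite mulmxA SX mulNmx -[X *m S *m X]mulmxA SX mulmxN opprK mulmxA.
have := congr1 (fun M => \det (M *m S)) conj.
rewrite -mulmxA S2 mulmx1 !det_mulmx mulrAC dS mul1r; exact.
Qed.

(** A rotation by a double angle is a square, and the rotation by an angle has
    the determinant of its inverse since S conjugates one to the other; so the
    square has determinant 1. *)
Lemma det_rotmx_double s c : s * s + c * c = 1 ->
  \det (rotmx (s * c + c * s) (c * c - s * s)) = 1.
Proof.
move=> sc; rewrite -rotmxD det_mulmx -{1}det_rotmxN -det_mulmx rotmxD.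
have -> : - s * c + c * s = 0 by ring.
have -> : c * c - - s * s = 1 by rewrite -sc; ring.
by rewrite rotmx0 det1.
Qed.

Variables (R : realType) (j : {rmorphism R -> K}).

Definition rott t := rotmx (j (sin t)) (j (cos t)).

Lemma rotD t t' : rott t *m rott t' = rott (t + t').
Proof. by rewrite /rott rotmxD sinD cosD !(rmorphD, rmorphN, rmorphM). Qed.

Lemma rotN t : rott t *m rott (- t) = 1%:M.
Proof. by rewrite rotD subrr /rott sin0 cos0 rmorph0 rmorph1 rotmx0. Qed.

Lemma det_rot t : \det (rott t) = 1.
Proof.
have -> : t = t / 2 + t / 2 by field.
rewrite -rotD /rott rotmxD det_rotmx_double // -!rmorphM -rmorphD.
by rewrite -!expr2 addrC cos2Dsin2 rmorph1.
Qed.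

End Rotation.

(* Conjugation by [reflect_a] or [swap_ab] changes the sign of the generator,
   which is what makes the determinant of its rotations equal to 1. *)
Section Generators.
Variables (K : fieldType) (N : nat) (a b : 'I_N).
Hypothesis ab : a != b.
Local Notation E := (@delta_mx K N N).

Let ab' : (a == b) = false := negbTE ab.
Let ba' : (b == a) = false. Proof. by rewrite eq_sym. Qed.

Let mulE := (mulmxDl, mulmxDr, mulmxN, mulNmx, mul1mx, mulmx1,
  mul_delta_mx_cond, eqxx, ab', ba').

Section Planar.
Variables z z' : K.
Hypothesis zz' : z * z' = 1.

Definition planar := z *: E a b - z' *: E b a.

Lemma planar2 : planar *m planar = - (E a a + E b b).
Proof.
rewrite /planar !mulE -!scalemxAl -!scalemxAr !mulE !mulr0n !mulr1n !scaler0.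
by rewrite !scalerA zz' mulrC zz' !scale1r; apply/matrixP => k l; rewrite !mxE; ring.
Qed.

Lemma planar3 : planar *m planar *m planar = - planar.
Proof.
rewrite planar2 /planar !mulE -!scalemxAr !mulE !mulr0n !mulr1n !scaler0.
by apply/matrixP => k l; rewrite !mxE; ring.
Qed.

Definition reflect_a := 1%:M - 2 *: E a a.

Lemma reflect_a2 : reflect_a *m reflect_a = 1%:M.
Proof.
rewrite /reflect_a !mulE -!scalemxAl -!scalemxAr !mulE !mulr1n !scalerA.
by apply/matrixP => k l; rewrite !mxE; ring.
Qed.

Lemma reflect_planar : reflect_a *m planar = - (planar *m reflect_a).
Proof.
rewrite /reflect_a /planar !(mulE, =^~ scalemxAl, =^~ scalemxAr).
rewrite ?mulr0n ?mulr1n ?scaler0 ?scalerA.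
by apply/matrixP => k l; rewrite !mxE; ring.
Qed.

End Planar.

Section Diagonal.
Variable z : K.
Hypothesis z2 : z * z = -1.

Definition axial := z *: (E a a - E b b).

Lemma axial2 : axial *m axial = - (E a a + E b b).
Proof.
rewrite /axial -!scalemxAl -!scalemxAr scalerA z2 !mulE !mulr0n !mulr1n.
by apply/matrixP => k l; rewrite !mxE; ring.
Qed.

Lemma axial3 : axial *m axial *m axial = - axial.
Proof.
rewrite axial2 /axial !mulE -!scalemxAr !mulE !mulr0n !mulr1n.
by apply/matrixP => k l; rewrite !mxE; ring.
Qed.

Definition swap_ab := 1%:M - (E a a + E b b) + (E a b + E b a).

Lemma swap_ab2 : swap_ab *m swap_ab = 1%:M.
Proof.
rewrite /swap_ab !mulE !mulr0n !mulr1n.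
by apply/matrixP => k l; rewrite !mxE; ring.
Qed.

Lemma swap_axial : swap_ab *m axial = - (axial *m swap_ab).
Proof.
rewrite /swap_ab /axial -!scalemxAr -!scalemxAl !mulE !mulr0n !mulr1n.
by apply/matrixP => k l; rewrite !mxE; ring.
Qed.

End Diagonal.
End Generators.

(** * Paths in SU(N) and SO(N) *)

Section Specialization.
Variables (R : realType) (N : nat).
Implicit Types (M X : 'M[R[i]]_N).

Local Notation C := (Num.NumField.sort (R[i] : numFieldType)).

Lemma continuous_Re : continuous (fun z : C => Re z : R).
Proof.
move=> z A /nbhs_ballP[eps e0 epsA]; apply/nbhs_ballP.
exists (eps%:C : C); first by rewrite /= ltcR.
move=> y; rewrite -ball_normE /= => zy; apply: epsA; rewrite -ball_normE /=.
rewrite -ltcR; apply: le_lt_trans zy.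
have -> : Re z - Re y = Re (z - y) by rewrite ReD; case: (y).
exact: normRe.
Qed.

Lemma continuous_Im : continuous (fun z : C => Im z : R).
Proof.
move=> z A /nbhs_ballP[eps e0 epsA]; apply/nbhs_ballP.
exists (eps%:C : C); first by rewrite /= ltcR.
move=> y; rewrite -ball_normE /= => zy; apply: epsA; rewrite -ball_normE /=.
rewrite -ltcR; apply: le_lt_trans zy.
have -> : Im z - Im y = Im (z - y) by rewrite ImD; case: (y).
exact: normIm.
Qed.

Lemma mx_bound M : exists2 C : R, 0 <= C & forall k l, `|M k l| <= C%:C.
Proof.
have rE k l : `|M k l| = (Re `|M k l|)%:C by rewrite RRe_real // normr_real.
have r0 k l : 0 <= Re `|M k l| by rewrite -ler0c -rE.
exists (\sum_k \sum_l Re `|M k l|).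
  by apply: sumr_ge0 => k _; apply: sumr_ge0.
move=> k l; rewrite rE lecR (bigD1 k) //= (bigD1 l) //= -addrA lerDl addr_ge0 //.
  by apply: sumr_ge0 => l' _; exact: r0.
by apply: sumr_ge0 => k' _; apply: sumr_ge0 => l' _; exact: r0.
Qed.

Lemma row_norm_bound (z : 'I_N -> R[i]) k : \sum_l z l * conjc (z l) = 1 -> `|z k| <= 1.
Proof.
move=> z1; rewrite -(@ler_pXn2r _ 2) ?nnegrE // expr1n -z1 (bigD1 k) //= -sqr_normc.
by rewrite lerDl sumr_ge0 // => l _; rewrite mulcJ_ge0.
Qed.

Local Notation crot X t := (rott X (real_complex R) t).

Lemma rott_tangent X : exists2 C : R, 0 <= C &
  forall t k l, `|(crot X t - 1%:M - t%:C *: X) k l| <= (C * t ^+ 2)%:C.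
Proof.
have [[C C0 XC] [C' C'0 XC']] := (mx_bound X, mx_bound (X *m X)).
exists (C + C'); first exact: addr_ge0.
move=> t k l; rewrite /rott /rotmx.
have -> : (1%:M + (sin t)%:C *: X + (1 - (cos t)%:C) *: (X *m X) - 1%:M - t%:C *: X) k l =
    (sin t - t)%:C * X k l + (1 - cos t)%:C * (X *m X) k l.
  move: (X *m X) => X2; rewrite !rmorphB rmorph1 !mxE; ring.
apply: le_trans (ler_normD _ _) _; rewrite mulrDl (rmorphD _ (C * _)) !normrM !normC_real.
apply: lerD; rewrite mulrC rmorphM; apply: ler_pM => //; rewrite ?ler0c // lecR.
  exact: sinB_quad.
by rewrite distrC; exact: cosB1_quad.
Qed.

End Specialization.

Section SpecialUnitary.
Variables (R : realType) (N : nat).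
Local Notation G := (SU R N).
Local Notation idC := (idfun : {rmorphism R[i] -> R[i]}).

Lemma SU_inv_entry (g : gelt G) k l : invmx (val g) k l = conjc (val g l k).
Proof.
have [ug _] := set_mem (valP g).
by rewrite invmx_unitary // !mxE.
Qed.

Lemma SU_entry_bound (g : gelt G) k l : `|val g k l| <= 1.
Proof.
apply: (row_norm_bound (z := fun l => val g k l)).
have [/unitarymxP ug _] := set_mem (valP g).
have := congr1 (fun M : 'M[_]_N => M k k) ug; rewrite !mxE eqxx => h; etransitivity; last exact: h.
by apply: eq_bigr => m _; rewrite !mxE.
Qed.

Section Path.
Variables X S : 'M[R[i]]_N.
Hypothesis X3 : X *m X *m X = - X.
Hypothesis S2 : S *m S = 1%:M.
Hypothesis SX : S *m X = - (X *m S).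
Hypothesis skew : map_mx (@conjc R) X^T = - X.

Local Notation crot t := (rott X (real_complex R) t).

Lemma conj_rott t : map_mx (@conjc R) (crot t)^T = crot (- t).
Proof.
have skew2 : map_mx (@conjc R) (X *m X)^T = X *m X.
  by rewrite trmx_mul map_mxM skew mulNmx mulmxN opprK.
have adjD (M M' : 'M[R[i]]_N) : map_mx (@conjc R) (M + M')^T =
    map_mx (@conjc R) M^T + map_mx (@conjc R) M'^T.
  by apply/matrixP => k l; rewrite !mxE rmorphD.
have adjZ (x : R) (M : 'M[R[i]]_N) : map_mx (@conjc R) (x%:C *: M)^T =
    x%:C *: map_mx (@conjc R) M^T.
  by apply/matrixP => k l; rewrite !mxE rmorphM; congr (_ * _); exact: conjc_real.
have cosE : 1 - (cos t)%:C = (1 - cos t)%:C by rewrite rmorphB rmorph1.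
rewrite /rott /rotmx sinN cosN cosE.
by rewrite !adjD !adjZ skew skew2 trmx1 map_mx1 scalerN rmorphN scaleNr.
Qed.

Lemma SU_rott t : SU_set (crot t).
Proof.
split; last exact: (det_rot X3 S2 SX).
by apply/unitarymxP; rewrite [X in _ *m X]conj_rott rotN.
Qed.

Definition SU_path t : gelt G := exist _ (crot t) (mem_set (SU_rott t)).

Lemma SU_path_inv t : val (ginv (SU_path t)) = crot (- t).
Proof.
rewrite /= -[RHS](mulKmx (SU_unit (SU_rott t))).
by rewrite rotN // mulmx1.
Qed.

Lemma SU_path_tangent : tangent idC SU_path X.
Proof.
have [C C0 XC] := rott_tangent X.
by exists C => // t k l _; rewrite map_mx_id //; exact: XC.
Qed.

Lemma SU_path_tangentV : tangent idC (fun t => ginv (SU_path t)) (- X).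
Proof.
have [C C0 XC] := rott_tangent X.
exists C => // t k l _; rewrite map_mx_id // SU_path_inv.
have := XC (- t) k l; rewrite sqrrN rmorphN scaleNr scalerN; exact.
Qed.

End Path.
End SpecialUnitary.

Section SpecialOrthogonal.
Variables (R : realType) (N : nat).
Local Notation G := (SO R N).
Local Notation toC := (real_complex R : {rmorphism R -> R[i]}).

Lemma SO_inv_tr (g : gelt G) : invmx (val g) = (val g)^T.
Proof.
have [og _] := set_mem (valP g).
by rewrite -[RHS](mulKmx (val_unit g)) og mulmx1.
Qed.

Lemma SO_entry_bound (g : gelt G) k l : `|toC (val g k l)| <= 1.
Proof.
apply: (row_norm_bound (z := fun l => toC (val g k l))).
have [og _] := set_mem (valP g).
have := congr1 (fun M : 'M[_]_N => toC (M k k)) og.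
rewrite !mxE eqxx => h; etransitivity; last exact: h.
by rewrite rmorph_sum; apply: eq_bigr => m _; rewrite mxE rmorphM; congr (_ * _); exact: conjc_real.
Qed.

Section Path.
Variables X S : 'M[R]_N.
Hypothesis X3 : X *m X *m X = - X.
Hypothesis S2 : S *m S = 1%:M.
Hypothesis SX : S *m X = - (X *m S).
Hypothesis skew : X^T = - X.

Local Notation id := (idfun : {rmorphism R -> R}).

Lemma tr_rott t : (rott X id t)^T = rott X id (- t).
Proof.
have skew2 : (X *m X)^T = X *m X by rewrite trmx_mul skew mulNmx mulmxN opprK.
have trD (M M' : 'M[R]_N) : (M + M')^T = M^T + M'^T.
  by apply/matrixP => k l; rewrite !mxE.
have trZ (x : R) (M : 'M[R]_N) : (x *: M)^T = x *: M^T.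
  by apply/matrixP => k l; rewrite !mxE.
by rewrite /rott /rotmx sinN cosN !trD !trZ skew skew2 trmx1 scalerN rmorphN scaleNr.
Qed.

Lemma SO_rott t : SO_set (rott X id t).
Proof. by split; [rewrite tr_rott rotN|exact: (det_rot X3 S2 SX)]. Qed.

Definition SO_path t : gelt G := exist _ (rott X id t) (mem_set (SO_rott t)).

Lemma map_rott t : map_mx toC (rott X id t) = rott (map_mx toC X) toC t.
Proof.
by rewrite /rott /rotmx !map_mxD !map_mxZ map_mx1 map_mxM rmorphB rmorph1.
Qed.

Lemma SO_path_tangent : tangent toC SO_path (map_mx toC X).
Proof.
have [C C0 XC] := rott_tangent (map_mx toC X).
by exists C => // t k l _; rewrite map_rott; exact: XC.
Qed.

Lemma SO_path_tangentV : tangent toC (fun t => ginv (SO_path t)) (- map_mx toC X).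
Proof.
have [C C0 XC] := rott_tangent (map_mx toC X).
exists C => // t k l _; have -> : val (ginv (SO_path t)) = rott X id (- t).
  by rewrite /= (SO_inv_tr (SO_path t)) tr_rott.
rewrite map_rott; have := XC (- t) k l.
by rewrite sqrrN rmorphN scaleNr scalerN; exact.
Qed.

End Path.
End SpecialOrthogonal.

(** * Linear functionals that vanish on the Lie algebra *)

Section Functionals.
Variables (R : realType) (N : nat) (p : 'M[R[i]]_N -> R[i]).
Hypothesis lin : forall c X X', p (c *: X + X') = c * p X + p X'.
Local Notation E := (@delta_mx R[i] N N).

Lemma functional0 : p 0 = 0.
Proof. by have := lin (-1) 0 0; rewrite scaler0 addr0 mulN1r addNr. Qed.

Lemma functionalZ c X : p (c *: X) = c * p X.
Proof. by have := lin c X 0; rewrite functional0 !addr0. Qed.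

Lemma functionalB X X' : p (X - X') = p X - p X'.
Proof. by rewrite addrC -scaleN1r lin mulN1r addrC. Qed.

Section Unitary.
Hypothesis p_skew : forall X S : 'M[R[i]]_N, X *m X *m X = - X -> S *m S = 1%:M ->
  S *m X = - (X *m S) -> map_mx (@conjc R) X^T = - X -> p X = 0.

Lemma functional_planar a b (z : R[i]) : a != b -> z * conjc z = 1 ->
  z * p (E a b) = conjc z * p (E b a).
Proof.
move=> ab zz; have : p (planar a b z (conjc z)) = 0.
  apply: p_skew (planar3 ab zz) (reflect_a2 _ a) (reflect_planar ab _ _) _.
  have conjB (u v : R[i]) : conjc (u - v) = conjc u - conjc v by exact: (rmorphB (@conjc R)).
  have conjM (u : R[i]) (q : bool) : conjc (u * q%:R) = conjc u * q%:R.
    by case: q; rewrite ?mulr1 // !mulr0 conjc0.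
  apply/matrixP => k l; rewrite !mxE conjB !conjM conjcK opprB.
  by rewrite [(l == a) && _]andbC [(l == b) && _]andbC.
by rewrite /planar functionalB !functionalZ => /eqP; rewrite subr_eq0 => /eqP.
Qed.

Let i_neq0 : ('i%C : R[i]) != 0.
Proof. by rewrite eq_complex /= oner_eq0 andbF. Qed.

(** The directions E_ab - E_ba and i (E_ab + E_ba) span E_ab over the complex
    numbers. *)
Lemma functional_off a b : a != b -> p (E a b) = 0.
Proof.
move=> ab; have := functional_planar ab (z := 1).
rewrite conjc1 !mul1r => /(_ erefl) e1.
have := functional_planar ab (z := 'i%C).
have ci : conjc ('i%C : R[i]) = - 'i%C by apply/eqP; rewrite eq_complex /= oppr0 !eqxx.
rewrite ci mulrN -expr2 sqr_i opprK => /(_ erefl).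
rewrite -e1 mulNr => /eqP; rewrite -addr_eq0 -mulr2n -mulr_natl mulf_eq0 pnatr_eq0 /=.
by rewrite mulf_eq0 (negbTE i_neq0) => /eqP.
Qed.

Lemma functional_diag a b : p (E a a) = p (E b b).
Proof.
case: (altP (a =P b)) => [->//|ab].
have ii : ('i%C : R[i]) * 'i%C = -1 by rewrite -expr2 sqr_i.
have : p (axial a b ('i%C : R[i])) = 0.
  apply: (p_skew (S := swap_ab _ a b) (axial3 ab ii)); [exact: swap_ab2|exact: swap_axial|].
  have conjN (u : bool) (v : bool) : conjc ('i%C * (u%:R - v%:R) : R[i]) =
      - ('i%C * (u%:R - v%:R)).
    by apply/eqP; rewrite eq_complex; case: u; case: v;
      rewrite /= ?(mul0r, mul1r, mulr0, mulr1, subr0, sub0r, subrr, addr0, add0r,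
                   oppr0, opprK) ?eqxx.
  by apply/matrixP => k l; rewrite !mxE conjN andbC [(l == b) && _]andbC.
rewrite /axial functionalZ functionalB => /eqP.
by rewrite mulf_eq0 (negbTE i_neq0) subr_eq0 => /eqP.
Qed.

End Unitary.

Section Orthogonal.
Hypothesis p_skew : forall X S : 'M[R]_N, X *m X *m X = - X -> S *m S = 1%:M ->
  S *m X = - (X *m S) -> X^T = - X -> p (map_mx (real_complex R) X) = 0.

Lemma functional_sym a b : p (E a b) = p (E b a).
Proof.
case: (altP (a =P b)) => [->//|ab].
have : p (map_mx (real_complex R) (planar a b 1 1)) = 0.
  apply: p_skew (planar3 ab _) (reflect_a2 _ a) (reflect_planar ab _ _) _.
    by rewrite mulr1.
  apply/matrixP => k l; rewrite !mxE !mul1r opprB.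
  by rewrite [(l == a) && _]andbC [(l == b) && _]andbC.
have -> : map_mx (real_complex R) (planar a b 1 1) = E a b - E b a.
  by rewrite /planar !scale1r map_mxB !map_delta_mx.
by rewrite functionalB => /eqP; rewrite subr_eq0 => /eqP.
Qed.

End Orthogonal.
End Functionals.

Lemma scale_equation (K : comPzRingType) (Z w t c d b w1 w2 w3 w4 w5 w6 w7 w8 : K) :
  t * w + w1 - w2 + c * w3 - c * w4 + d * w5 - d * w6 + b * w7 - b * w8 = 0 ->
  t * (Z * w) = - (Z * w1) + Z * w2 - c * (Z * w3) + c * (Z * w4)
    - d * (Z * w5) + d * (Z * w6) - b * (Z * w7) + b * (Z * w8).
Proof.
by move=> H; apply/eqP; rewrite -subr_eq0 -(mulr0 Z) -H; apply/eqP; ring.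
Qed.

Lemma edge_at_split (L : finite_graph) (s : string L) i j e :
  edge_at s i j = Some e ->
  loop_at s i = take j (loop_at s i) ++ e :: drop j.+1 (loop_at s i) /\
  size (take j (loop_at s i)) = j.
Proof.
rewrite /edge_at; move: (loop_at s i) => l.
elim: l j => [|x l IH] [|j] //=; first by move=> [->]; rewrite drop0.
by move=> /IH[<- ->].
Qed.

(** * The loop equations *)

Section LoopEquations.
Variables (R : realType) (N : nat) (L : finite_graph).
Variables (P : seq (seq (oedge L))) (s : string L) (i : nat) (e : oedge L).
Variables (A B : seq (oedge L)) (beta : R).
Hypothesis N_gt0 : (0 < N)%N.
Hypothesis si : loop_at s i = A ++ e :: B.

Section Unitary.
Variables (mu : probability (gborel (SU R N)) R).
Variable nu : probability (gconfig (SU R N) (pedge L)) R.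
Hypotheses (haar : is_haar mu) (prod : is_product mu nu).

Local Notation idC := (idfun : {rmorphism R[i] -> R[i]}).
Local Notation E := (@delta_mx R[i] N N).
Local Notation pair X Y := (pairing idC P s i e A B beta nu X Y).

Let lin Y := pairing_linearX (iota := idC) (@continuous_Re R) (@continuous_Im R)
  (@SU_entry_bound R N) (@SU_inv_entry R N) P s i e A B beta nu Y.

Lemma SU_pairing (X S : 'M[R[i]]_N) Y : X *m X *m X = - X -> S *m S = 1%:M ->
  S *m X = - (X *m S) -> map_mx (@conjc R) X^T = - X -> pair X Y = 0.
Proof.
move=> X3 S2 SX skew.
exact: (pairing_path (iota := idC) (@continuous_Re R) (@continuous_Im R)
  (@SU_entry_bound R N) (@SU_inv_entry R N) P s i e A B beta haar prod Y
  (SU_path_tangent X3 S2 SX skew) (SU_path_tangentV X3 S2 SX skew)).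
Qed.

Lemma SU_pairing_off a b Y : a != b -> pair (E a b) Y = 0.
Proof.
move=> ab; apply: (functional_off (p := fun X => pair X Y) _ _ ab).
  by move=> c X X'; exact: (lin Y c X X').
by move=> X S X3 S2 SX skew; exact: SU_pairing X3 S2 SX skew.
Qed.

Lemma SU_pairing_diag a b Y : pair (E a a) Y = pair (E b b) Y.
Proof.
apply: (functional_diag (p := fun X => pair X Y)).
  by move=> c X X'; exact: (lin Y c X X').
by move=> X S X3 S2 SX skew; exact: SU_pairing X3 S2 SX skew.
Qed.

Lemma phiSU_wexp s' :
  phiSU P beta nu s' = (cintegral nu (weightSU P beta))^-1 * wexp idC P beta nu s'.
Proof.
have linkE Q : clink idC Q = link Q by apply/funext => x; rewrite /clink map_mx_id.
by congr (_ * cintegral _ _); apply/funext => Q; rewrite /weight linkE.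
Qed.

Lemma SU_loop_equation : let phi := phiSU P beta nu in
  (1 - (tcount e s)%:~R / N%:R ^+ 2) * phi s =
  - (\sum_(s' <- split_pos e i (size A) s) phi s')
  + \sum_(s' <- split_neg e i (size A) s) phi s'
  - (N%:R ^+ 2)^-1 * (\sum_(s' <- mergeU_pos e i (size A) s) phi s')
  + (N%:R ^+ 2)^-1 * (\sum_(s' <- mergeU_neg e i (size A) s) phi s')
  - beta%:C * (\sum_(s' <- deform_pos P e i (size A) s) phi s')
  + beta%:C * (\sum_(s' <- deform_neg P e i (size A) s) phi s')
  - beta%:C * (\sum_(s' <- expand_pos P e s) phi s')
  + beta%:C * (\sum_(s' <- expand_neg P e s) phi s').
Proof.
have := loop_equation_sl (iota := idC) (@continuous_Re R) (@continuous_Im R)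
  (@SU_entry_bound R N) (@SU_inv_entry R N) N_gt0 si (P := P) (beta := beta) (nu := nu)
  SU_pairing_off SU_pairing_diag.
move=> loopeq /=; have -> : phiSU P beta nu =
    fun s' => (cintegral nu (weightSU P beta))^-1 * wexp idC P beta nu s'.
  by apply/funext => s'; exact: phiSU_wexp.
rewrite -!mulr_sumr; exact: scale_equation loopeq.
Qed.

End Unitary.

Section Orthogonal.
Variables (mu : probability (gborel (SO R N)) R).
Variable nu : probability (gconfig (SO R N) (pedge L)) R.
Hypotheses (haar : is_haar mu) (prod : is_product mu nu).
Hypothesis plaqP : plaquette_set P.

Local Notation toC := (real_complex R : {rmorphism R -> R[i]}).
Local Notation E := (@delta_mx R[i] N N).
Local Notation pair X Y := (pairing toC P s i e A B beta nu X Y).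

Let Re_toC : continuous (fun z : R => Re (toC z)).
Proof. by move=> z; exact: cvg_id. Qed.

Let Im_toC : continuous (fun z : R => Im (toC z)).
Proof. by move=> z; exact: cvg_cst. Qed.

Let toC_inv (g : gelt (SO R N)) k l :
  toC (invmx (val g) k l) = conjc (toC (val g l k)).
Proof. by rewrite SO_inv_tr mxE; exact/esym/conjc_real. Qed.

Let lin Y := pairing_linearX (iota := toC) Re_toC Im_toC
  (@SO_entry_bound R N) toC_inv P s i e A B beta nu Y.

Lemma SO_pairing (X S : 'M[R]_N) Y : X *m X *m X = - X -> S *m S = 1%:M ->
  S *m X = - (X *m S) -> X^T = - X -> pair (map_mx toC X) Y = 0.
Proof.
move=> X3 S2 SX skew.
exact: (pairing_path (iota := toC) Re_toC Im_toC
  (@SO_entry_bound R N) toC_inv P s i e A B beta haar prod Y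
  (SO_path_tangent X3 S2 SX skew) (SO_path_tangentV X3 S2 SX skew)).
Qed.

Lemma SO_pairing_sym a b Y : pair (E a b) Y = pair (E b a) Y.
Proof.
apply: (functional_sym (p := fun X => pair X Y)).
  by move=> c X X'; exact: (lin Y c X X').
by move=> X S X3 S2 SX skew; exact: SO_pairing X3 S2 SX skew.
Qed.

Lemma SO_clink_tr (Q : gconfig (SO R N) (pedge L)) (x : oedge L) :
  clink toC Q (oinv x) = (clink toC Q x)^T.
Proof.
rewrite /clink /link map_trmx; congr map_mx; case: x => a [] /=.
  exact: SO_inv_tr.
by rewrite SO_inv_tr trmxK.
Qed.

Lemma map_holonomy (Q : gconfig (SO R N) (pedge L)) l :
  hol (clink toC Q) l = map_mx toC (holonomy Q l).
Proof.
elim: l => [|x l IH]; first by rewrite hol_nil /holonomy big_nil map_mx1.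
by rewrite hol_cons IH /holonomy big_cons map_mxM.
Qed.

Lemma trh_real (Q : gconfig (SO R N) (pedge L)) l : trh (clink toC Q) l = (\tr (holonomy Q l))%:C.
Proof. by rewrite /trh map_holonomy trace_map_mx. Qed.

Lemma cintegral_real (f : gconfig (SO R N) (pedge L) -> R) :
  cintegral nu (fun Q => (f Q)%:C) = (Rintegral nu setT f)%:C.
Proof. by rewrite /cintegral /= Rintegral_cst // mul0r. Qed.

Lemma wexp_real s' : wexp toC P beta nu s' =
  (Rintegral nu setT (fun Q => wilson s' Q * weightSO P beta Q))%:C.
Proof.
rewrite -cintegral_real; congr (cintegral _ _); apply/funext => Q.
rewrite rmorphM; congr (_ * _).
  rewrite /wil /wilson rmorph_prod; apply: eq_bigr => l _.
  by rewrite trh_real rmorphM fmorphV rmorph_nat.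
rewrite /weight /weightSO rmorph_prod; apply: eq_bigr => p _.
rewrite trh_real; etransitivity; last exact: cexp_real.
by rewrite !rmorphM rmorph_nat.
Qed.

Lemma SO_loop_equation : let phi := phiSO P beta nu in
  (1 - N%:R^-1) * phi s =
  - (\sum_(s' <- split_pos e i (size A) s) phi s')
  + \sum_(s' <- split_neg e i (size A) s) phi s'
  - (N%:R ^+ 2)^-1 * (\sum_(s' <- merge_pos e i (size A) s) phi s')
  + (N%:R ^+ 2)^-1 * (\sum_(s' <- merge_neg e i (size A) s) phi s')
  - N%:R^-1 * (\sum_(s' <- twist_pos e i (size A) s) phi s')
  + N%:R^-1 * (\sum_(s' <- twist_neg e i (size A) s) phi s')
  - 2 * beta * (\sum_(s' <- deform_pos P e i (size A) s) phi s')
  + 2 * beta * (\sum_(s' <- deform_neg P e i (size A) s) phi s').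
Proof.
pose w s' := Rintegral nu setT (fun Q => wilson s' Q * weightSO P beta Q).
have := loop_equation_so (iota := toC) Re_toC Im_toC
  (@SO_entry_bound R N) toC_inv N_gt0 si (P := P) (beta := beta) (nu := nu)
  SO_clink_tr plaqP SO_pairing_sym.
have -> : wexp toC P beta nu = fun s' => (w s')%:C.
  by apply/funext => s'; exact: wexp_real.
move=> loopeq; rewrite /phiSO /= -!mulr_sumr; apply: scale_equation.
apply: (@complexI R); rewrite -[RHS]loopeq.
by rewrite !(rmorphD, rmorphN, rmorphM, rmorph_sum, fmorphV, rmorphXn, rmorph_nat, rmorph1).
Qed.

End Orthogonal.
End LoopEquations.

Theorem theorem6p104 (R : realType) (N : nat) (hN : (1 <= N)%N)
    (beta : R) (hbeta : 0 < beta) (L : finite_graph)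
    (P : seq (seq (oedge L))) (hP : plaquette_set P)
    (s : string L) (hs : all (@is_loop L) s)
    (i j : nat) (e : oedge L) (he : edge_at s i j = Some e) :
  (forall (mu : probability (gborel (SU R N)) R)
          (nu : probability (gconfig (SU R N) (pedge L)) R),
     is_haar mu -> is_product mu nu ->
     let phi := phiSU P beta nu in
     (1 - (tcount e s)%:~R / N%:R ^+ 2) * phi s =
       - (\sum_(s' <- split_pos e i j s) phi s')
       + \sum_(s' <- split_neg e i j s) phi s'
       - (N%:R ^+ 2)^-1 * (\sum_(s' <- mergeU_pos e i j s) phi s')
       + (N%:R ^+ 2)^-1 * (\sum_(s' <- mergeU_neg e i j s) phi s')
       - beta%:C * (\sum_(s' <- deform_pos P e i j s) phi s')
       + beta%:C * (\sum_(s' <- deform_neg P e i j s) phi s')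
       - beta%:C * (\sum_(s' <- expand_pos P e s) phi s')
       + beta%:C * (\sum_(s' <- expand_neg P e s) phi s')) /\
  (forall (mu : probability (gborel (SO R N)) R)
          (nu : probability (gconfig (SO R N) (pedge L)) R),
     is_haar mu -> is_product mu nu ->
     let phi := phiSO P beta nu in
     (1 - N%:R^-1) * phi s =
       - (\sum_(s' <- split_pos e i j s) phi s')
       + \sum_(s' <- split_neg e i j s) phi s'
       - (N%:R ^+ 2)^-1 * (\sum_(s' <- merge_pos e i j s) phi s')
       + (N%:R ^+ 2)^-1 * (\sum_(s' <- merge_neg e i j s) phi s')
       - N%:R^-1 * (\sum_(s' <- twist_pos e i j s) phi s')
       + N%:R^-1 * (\sum_(s' <- twist_neg e i j s) phi s')
       - 2 * beta * (\sum_(s' <- deform_pos P e i j s) phi s')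
       + 2 * beta * (\sum_(s' <- deform_neg P e i j s) phi s')).
Proof.
have [si <-] := edge_at_split he.
split=> mu nu haar prod; first exact: (SU_loop_equation P beta hN si haar prod).
exact: (SO_loop_equation beta hN si haar prod hP).
Qed.
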